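(* Let $(X,d)$ be a locally compact metric space and let $g$ be a doubling dimension function for which there exist constants $0<c_1<1<c_2<\infty$ and $r_0>0$ such that $$c_1\, g(r)\le \mathcal{H}^g(B(x,r))\le c_2\, g(r)\qquad\text{for all } x\in X \text{ and } 0<r<r_0 .$$ Let $\mathcal{F}:=(F_j)_{j\in\mathbb{N}}$ be a sequence of sets in $X$ satisfying the local scaling property (LSP) with respect to some $0\le\kappa<1$, and let $\Upsilon:=(\Upsilon_j)_{j\in\mathbb{N}}$ be a sequence of non-negative reals such that $\Upsilon_j\to 0$ as $j\to\infty$. Let $f$ be a dimension function such that $f/g$ is monotonic and $f/g^{\kappa}$ is a dimension function. Suppose that for any ball $B$ in $X$ we have $$\mathcal{H}^g\left(B\cap \Lambda\left(g^{-1}\left(\left(\frac{f(\Upsilon)}{g(\Upsilon)^{\kappa}}\right)^{\frac{1}{1-\kappa}}\right)\right)\right)=\mathcal{H}^g(B).$$ Then, for any ball $B$ in $X$ we have $$\mathcal{H}^f(B\cap\Lambda(\Upsilon))=\mathcal{H}^f(B).$$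
   Context: Notation: $\mathbb{R}^+=[0,\infty)$. A dimension function is a left continuous, non-decreasing function $f:\mathbb{R}^+\to\mathbb{R}^+$ with $f(r)\to 0$ as $r\to 0$. A function $f:\mathbb{R}^+\to\mathbb{R}^+$ is doubling if there is a constant $\lambda>1$ with $f(2x)<\lambda f(x)$ for all $x>0$. $g^{-1}$ denotes the inverse function of $g$. Hausdorff $f$-measure: for $F\subset X$ and $\rho>0$, a $\rho$-cover of $F$ is a countable collection of balls $\{B_i\}$ with radii $r(B_i)<\rho$ and $F\subset\bigcup_i B_i$; $\mathcal{H}^f_\rho(F):=\inf\{\sum_i f(r(B_i)) : \{B_i\}\text{ is a }\rho\text{-cover of }F\}$, and $\mathcal{H}^f(F):=\lim_{\rho\to0}\mathcal{H}^f_\rho(F)$. Neighbourhoods: for $F\subset X$ and $\delta\ge0$, $\Delta(F,\delta):=\{x\in X: d(x,F)<\delta\}$, where $d(x,F):=\min\{d(x,y):y\in F\}$. Local scaling property (LSP): given a sequence of sets $\mathcal{F}=(F_j)_{j\in\mathbb{N}}$ in $X$ and $0\le\kappa<1$, $\mathcal{F}$ satisfies the LSP with respect to $\kappa$ if there exist constants $c_3,c_4,r_1>0$ such that for any $0<r<r_1$, $\delta<r$, $j\in\mathbb{N}$ and $x\in F_j$, $$c_3\, g(\delta)^{1-\kappa} g(r)^{\kappa}\le\mathcal{H}^g(B(x,r)\cap\Delta(F_j,\delta))\le c_4\, g(\delta)^{1-\kappa}g(r)^{\kappa}.$$ Limsup sets: for a sequence $\Upsilon=(\Upsilon_j)_{j\in\mathbb{N}}$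 of non-negative reals, $\Lambda(\Upsilon):=\{x\in X: x\in\Delta(F_j,\Upsilon_j)\text{ for infinitely many } j\in\mathbb{N}\}$. For a function $\psi$, $\psi(\Upsilon)$ denotes the sequence obtained termwise; thus $g^{-1}\big((f(\Upsilon)/g(\Upsilon)^\kappa)^{1/(1-\kappa)}\big)$ is the sequence with $j$-th term $g^{-1}\big((f(\Upsilon_j)/g(\Upsilon_j)^\kappa)^{1/(1-\kappa)}\big)$. *)

(* Defs.v *)
From HB Require Import structures.
From mathcomp Require Import all_boot all_order all_algebra.
From mathcomp Require Import all_classical all_reals all_analysis.

Set Implicit Arguments.
Unset Strict Implicit.
Unset Printing Implicit Defensive.

Import Order.TTheory GRing.Theory Num.Theory.
Import numFieldNormedType.Exports.

Local Open Scope classical_set_scope.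
Local Open Scope ring_scope.

(* Functions from [0, +oo[ to itself are represented by functions f : R -> R
   of which only the restriction to [0, +oo[ is ever constrained or used. *)

(* The conditions force f 0 = 0. *)
Definition dimension_function (R : realType) (f : R -> R) : Prop :=
  [/\ forall x, 0 <= x -> 0 <= f x,
      forall x y, 0 <= x -> x <= y -> f x <= f y,
      forall x, 0 < x -> f y @[y --> x^'-] --> f x &
      f y @[y --> 0^'+] --> 0].

Definition doubling (R : realType) (f : R -> R) : Prop :=
  exists2 lambda : R, 1 < lambda & forall x, 0 < x -> f (2 * x) < lambda * f x.

(* A dimension function need be neither injective nor continuous, so its
   inverse is taken in the generalized sense. By left continuity the supremum
   is attained as soon as y is smaller than some value of g. The lemmas
   ginvK and ginvKr below show that this is the inverse of g whenever g is
   injective. *)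
Definition ginv (R : realType) (g : R -> R) (y : R) : R :=
  sup [set x | 0 <= x /\ g x <= y].

Lemma ginvK (R : realType) (g : R -> R) (x : R) :
  dimension_function g ->
  (forall u v, 0 <= u -> 0 <= v -> g u = g v -> u = v) ->
  0 <= x -> ginv g (g x) = x.
Proof.
move=> [_ ndg _ _] injg x0; rewrite /ginv.
have -> : [set t | 0 <= t /\ g t <= g x] = [set` `[0, x]].
  apply/seteqP; split=> t /=; rewrite in_itv /=.
    move=> [t0 gtx]; rewrite t0 /= leNgt; apply/negP => xt.
    have e : g t = g x.
      by apply/eqP; rewrite eq_le gtx ndg// ltW.
    by move: xt; rewrite (injg _ _ t0 x0 e) ltxx.
  by move=> /andP[t0 tx]; split=> //; exact: ndg.
exact: sup_itvcc.
Qed.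

Lemma ginvKr (R : realType) (g : R -> R) (y : R) :
  dimension_function g ->
  (forall u v, 0 <= u -> 0 <= v -> g u = g v -> u = v) ->
  (exists2 x, 0 <= x & g x = y) -> g (ginv g y) = y.
Proof. by move=> gdim injg [x x0 <-]; rewrite ginvK. Qed.

(* A countable collection of open balls is encoded by the countable set C of
   the pairs (center, radius), so that r(B_i) is meaningful even when a ball
   of X, as a set, has several centers or radii. *)
Definition rho_cover (R : realType) (X : metricType R) (rho : R) (F : set X)
    (C : set (X * R)) : Prop :=
  [/\ countable C,
      forall b, C b -> 0 < b.2 < rho &
      F `<=` \bigcup_(b in C) ball b.1 b.2].

(* The infimum is +oo when F has no rho-cover. *)
Definition hausdorff_content (R : realType) (X : metricType R) (f : R -> R)
    (rho : R) (F : set X) : \bar R :=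
  ereal_inf [set (\esum_(b in C) (f b.2)%:E)%E | C in rho_cover rho F].

Definition hausdorff (R : realType) (X : metricType R) (f : R -> R)
    (F : set X) : \bar R :=
  lim (hausdorff_content f rho F @[rho --> 0^'+]).

Lemma hausdorff_cvg (R : realType) (X : metricType R) (f : R -> R)
    (F : set X) :
  hausdorff_content f rho F @[rho --> 0^'+] --> hausdorff f F.
Proof.
apply: (@nonincreasing_at_right_is_cvge _ _ 0).
near=> b => r s _ _ rs.
apply: ereal_inf_le_tmp => _ [C [cC rC FC] <-]; exists C => //; split=> //.
by move=> c /rC /andP[-> /lt_le_trans]; exact.
Unshelve. all: by end_near.
Qed.

(* The distance is an infimum (+oo if F is empty): a minimum need not exist
   when F is not closed. *)
Definition set_dist (R : realType) (X : metricType R) (x : X) (F : set X) :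
    \bar R :=
  ereal_inf [set (mdist x y)%:E | y in F].

Definition nbhood (R : realType) (X : metricType R) (F : set X) (delta : R) :
    set X :=
  [set x | (set_dist x F < delta%:E)%E].

Definition local_scaling (R : realType) (X : metricType R) (g : R -> R)
    (F : nat -> set X) (kappa : R) : Prop :=
  exists c3 c4 r1 : R, [/\ 0 < c3, 0 < c4, 0 < r1 &
    forall (r delta : R) (j : nat) (x : X),
      0 < r < r1 -> 0 <= delta < r -> F j x ->
      ((c3 * (g delta `^ (1 - kappa) * g r `^ kappa))%:E
         <= hausdorff g (ball x r `&` nbhood (F j) delta)
         <= (c4 * (g delta `^ (1 - kappa) * g r `^ kappa))%:E)%E].

Definition limsup_nbhood (R : realType) (X : metricType R) (F : nat -> set X)
    (Upsilon : nat -> R) : set X :=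
  [set x | infinite_set [set j | nbhood (F j) (Upsilon j) x]].

(* Main.v *)
Require Import Defs.
From HB Require Import structures.
From mathcomp Require Import all_boot all_order all_algebra ring lra.
From mathcomp Require Import all_classical all_reals all_analysis.

Set Implicit Arguments.
Unset Strict Implicit.
Unset Printing Implicit Defensive.

Import Order.TTheory GRing.Theory Num.Theory.
Import numFieldNormedType.Exports.

Local Open Scope classical_set_scope.
Local Open Scope ring_scope.

(* Write mu for the Hausdorff g-measure, R_j for the radius attached to
   Upsilon_j in the hypothesis, Lg and La for the limsup sets with radii R_j and
   Upsilon_j, and G_n for the union of the neighbourhoods of F_j of radius
   Upsilon_j over j >= n. Only outer measure properties of mu are used:
   countable subadditivity and superadditivity on sets at positive distance.

   If f / g is bounded near 0, then g (R_j) is at most a constant times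
   g (Upsilon_j). A Vitali covering of Lg shows that G_n fills a fixed
   proportion of every small ball, and even of every open set V, at a positive
   distance from the complement of G_n. Taking for V an almost optimal open
   neighbourhood of a ball minus G_n forces the latter to be mu-null. Hence the
   complement of La is null for mu, and for the Hausdorff f-measure.

   Otherwise f / g is nonincreasing and unbounded near 0, and the f-measure of
   La in any ball is infinite. Suppose that balls b_i with the sum of f (r_i)
   finite cover La in a ball. Call a ball sparse if the sum of g (r_i) over the
   b_i close to it is at most c0 times g of its radius. Inside a sparse ball B
   there is a sparse ball of arbitrarily small radius contained in G_n: if not,
   consider a point of Lg in B outside the fivefold enlargements of the b_i. It
   lies within R_j of F_j for arbitrarily large j, and every ball of radius
   Upsilon_j / 2 centered there in F_j fails to be sparse; local scaling and
   the monotonicity of f / g^kappa then give mass at least a constant times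
   g (R_j) to the sum of the f (r_i) over the b_i of radius less than R_j around
   that point. A Vitali covering by such balls bounds mu B by a tail of the
   convergent sum of the f (r_i), a contradiction. The nested sparse balls so
   obtained shrink to a point of La lying in no b_i. *)

Lemma subset_esum {R : realType} {T : choiceType} (A B : set T) (a : T ->
  \bar R) :
   A `<=` B -> (\esum_(i in A) a i <= \esum_(i in B) a i)%E.
Proof.
move=> AB; apply: ge_ereal_sup => _ [F [finF FA] <-].
by apply: ereal_sup_ubound; exists F => //; split=> // t /FA /AB.
Qed.

(** * Sums of nonnegative families *)

(** Finitely many thresholds have a positive minimum, and [P i] survives shrinking of the
    threshold. *)
Lemma common_pos_witness {R : realType} {I : eqType} (s : seq I)
    (P : I -> R -> Prop) :
  (forall i d d', 0 < d' <= d -> P i d -> P i d') ->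
  (forall i, i \in s -> exists2 d : R, 0 < d & P i d) ->
  exists2 d : R, 0 < d & forall i, i \in s -> P i d.
Proof.
move=> Pmon; elim: s => [|i s IHs] sP; first by exists 1.
have [|d d0 dP] := IHs; first by move=> j js; apply: sP; rewrite inE js orbT.
have [d' d'0 d'P] := sP i (mem_head _ _).
exists (Order.min d d'); first by rewrite lt_min d0.
move=> j /[!inE] /orP[/eqP->|js].
  by apply: Pmon d'P; rewrite lt_min d0 d'0 ge_min lexx orbT.
by apply: Pmon (dP _ js); rewrite lt_min d0 d'0 ge_min lexx.
Qed.

Section esum_complements.
Local Open Scope ereal_scope.
Context {R : realType} {T : choiceType}.
Implicit Types (A B : set T) (a : T -> \bar R).

Lemma esum_ge_elt A a t : A t -> 0 <= a t -> a t <= \esum_(i in A) a i.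
Proof.
by move=> At at0; rewrite -esum_set1//; apply: subset_esum => _ ->.
Qed.

Lemma esumZl_le A a (k : R) : (0 <= k)%R -> (forall i, A i -> 0 <= a i) ->
  \esum_(i in A) (k%:E * a i) <= k%:E * \esum_(i in A) a i.
Proof.
move=> k0 a0; apply: ge_ereal_sup => _ [F [finF FA] <-].
rewrite fsbig_finite//= big_seq -ge0_sume_distrr; last first.
  by move=> i /[!in_fset_set]// /[!inE] /FA /a0.
rewrite lee_wpmul2l ?lee_fin// -big_seq -fsbig_finite//.
by apply: ereal_sup_ubound; exists F.
Qed.

(** The pairs [(i, t)] project injectively to [t]. This adds up the masses attached to the disjoint
    balls of a Vitali family. *)
Lemma esum_disjoint_le {I : choiceType} (D : set I) (K : I -> set T) B a :
  (forall i t, D i -> K i t -> B t) -> (forall t, B t -> 0 <= a t) ->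
  (forall i j t, D i -> D j -> K i t -> K j t -> i = j) ->
  \esum_(i in D) \esum_(t in K i) a t <= \esum_(t in B) a t.
Proof.
move=> KB a0 disjK; rewrite esum_esum; last first.
  by move=> i t Di Kit; apply: a0; apply: KB Kit.
rewrite -(@esum_image R _ _ (D `*`` K) (fun p => p.2) a).
  by apply: subset_esum => _ [[i t] [/= Di Kit] <-]; apply: KB Kit.
move=> [i t] [j u] /=; rewrite !inE => -[/= Di Kit] [/= Dj Kju] tu; subst u.
by rewrite (disjK i j t).
Qed.

(* Every t in the union is attributed to one of the sets containing it. *)
Lemma esum_bigcup_le {I : choiceType} (D : set I) (K : I -> set T) a :
  (forall i t, D i -> K i t -> 0 <= a t) ->
  \esum_(t in \bigcup_(i in D) K i) a t <=
  \esum_(i in D) \esum_(t in K i) a t.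
Proof.
move=> a0; rewrite esum_esum//.
set U := \bigcup_(i in D) K i.
have /choice[s sP] (t : {t | U t}) : exists i, D i /\ K i (sval t).
  by case: t => t [i Di Kit]; exists i.
pose V := [set p : I * T | exists q : {t | U t}, p = (s q, sval q)].
have -> : U = snd @` V.
  apply/seteqP; split=> [t Ut|t [_ [[u Uu] ->] <-]//].
  by exists (s (exist _ t Ut), t) => //; exists (exist _ t Ut).
rewrite esum_image; last first.
  move=> _ _ /[!inE] -[[t Ut] ->] [[u Uu] ->] /= tu; subst u.
  by rewrite (Prop_irrelevance Ut Uu).
by apply: subset_esum => _ [q ->] /=; split; case: (sP q).
Qed.

(* Take d below the weights s of a finite set of indices whose terms exhaust the
   sum up to e. *)
Lemma esum_tail (C : set T) (s : T -> R) (a : T -> \bar R) (e : R) :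
  (forall t, C t -> 0 < s t)%R -> (forall t, C t -> 0 <= a t) ->
  \esum_(t in C) a t < +oo -> (0 < e)%R ->
  exists2 d : R, (0 < d)%R & \esum_(t in C `&` [set t | (s t < d)%R]) a t <
    e%:E.
Proof.
move=> s0 a0 Coo e0.
have Cfin : \esum_(t in C) a t \is a fin_num.
  by rewrite ge0_fin_numE// esum_ge0.
have [_ [F [finF FC] <-] CF] := ub_ereal_sup_adherent e0 Cfin.
have [d d0 dP] : exists2 d : R, (0 < d)%R & forall t, F t -> (d <= s t)%R.
  have /finite_seqP[l FE] := finF; rewrite FE.
  apply: (common_pos_witness (P := fun t d => d <= s t)%R) => [t d d'|t tl].
    by move=> /andP[_]; exact: le_trans.
  by exists (s t); rewrite // s0//; apply: FC; rewrite FE.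
exists d => //.
set G := C `&` _.
have FG : F `<=` C `&` ~` G.
  by move=> t Ft; split; [exact: FC|move=> [_ /= td]; have := dP _ Ft;
    rewrite leNgt td].
have GC : C `&` G = G by apply/seteqP; split=> t; [case|move=> Gt;
  split => //; case: Gt].
have := esumID G C a a0; rewrite GC => CE.
have Gfin : \esum_(t in G) a t \is a fin_num.
  rewrite ge0_fin_numE; last by apply: esum_ge0 => t [/a0].
  by apply: le_lt_trans Coo; apply: subset_esum => t [].
rewrite -(@lteD2rE _ (\esum_(t in C `&` ~` G) a t)); last first.
  rewrite ge0_fin_numE; last by apply: esum_ge0 => t [/a0].
  by apply: le_lt_trans Coo; apply: subset_esum => t [].
rewrite -CE addeC.
rewrite -/(esum C a) in CF.
apply: (@lt_le_trans _ _ (\sum_(i \in F) a i + e%:E));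
  first by rewrite -lteBlDr.
rewrite leeD2r// -esum_fset//; first exact: subset_esum.
by move=> t /[!inE] /FC /a0.
Qed.

End esum_complements.

(** * Neighbourhoods and the Hausdorff measure *)

Section metric_sets.
Context {R : realType} {X : metricType R}.
Implicit Types (x y z : X) (r s : R) (A E F : set X).

Lemma ballP x y r : ball x r y <-> mdist x y < r.
Proof. by rewrite ballEmdist. Qed.

Lemma ball_subset x y r s : mdist x y + s <= r -> ball y s `<=` ball x r.
Proof.
move=> xysr z /ballP yz; apply/ballP.
by have := metric_triangle x y z; lra.
Qed.

Lemma nbhoodP F r x : nbhood F r x <-> exists2 y, F y & mdist x y < r.
Proof.
split=> [/ereal_inf_lt[_ [y Fy <-]]|[y Fy xy]]; first by rewrite lte_fin;
  exists y.
rewrite /nbhood/= /set_dist; apply: (@le_lt_trans _ _ (mdist x y)%:E);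
  last by rewrite lte_fin.
by apply: ereal_inf_lbound; exists y.
Qed.

Lemma open_ballP A : open A <-> forall x, A x ->
  exists2 r, 0 < r & ball x r `<=` A.
Proof.
split=> [oA x Ax|Ax].
  by have /nbhs_ballP[r /= r0 rA] := open_nbhs_nbhs (conj oA Ax); exists r.
rewrite openE => x /Ax[r r0 rA]; apply/nbhs_ballP; exists r => //.
Qed.

Lemma open_ball x r : open (ball x r).
Proof.
apply/open_ballP => y /ballP xy; exists (r - mdist x y);
  first by rewrite subr_gt0.
by apply: ball_subset; lra.
Qed.

Lemma open_nbhood F r : open (nbhood F r).
Proof.
apply/open_ballP => x /nbhoodP[y Fy xy]; exists (r - mdist x y);
  first by rewrite subr_gt0.
move=> z /ballP xz; apply/nbhoodP; exists y => //.
have := metric_triangle z x y; rewrite (metric_sym z x); lra.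
Qed.

End metric_sets.

Section hausdorff_measure.
Local Open Scope ereal_scope.
Context {R : realType} {X : metricType R}.
Variables (f : R -> R) (f0 : forall x : R, (0 <= x -> 0 <= f x)%R).
Implicit Types (A B E F : set X) (rho : R) (C : set (X * R)).

Lemma rho_cover_ge0 rho F C b : rho_cover rho F C -> C b -> 0 <= (f b.2)%:E.
Proof. by move=> [_ C0 _] /C0/andP[b0 _]; rewrite lee_fin f0// ltW. Qed.

Lemma hausdorff_content_ge0 rho F : 0 <= hausdorff_content f rho F.
Proof.
apply: le_ereal_inf_tmp => _ [C FC <-]; apply: esum_ge0 => b Cb.
exact: rho_cover_ge0 FC Cb.
Qed.

Lemma rho_coverS rho rho' A B C : (rho' <= rho)%R -> A `<=` B ->
  rho_cover rho' B C -> rho_cover rho A C.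
Proof.
move=> rr AB [cC rC BC]; split=> //; last exact: subset_trans AB BC.
by move=> b /rC /andP[-> /lt_le_trans]; exact.
Qed.

Lemma le_hausdorff_content rho rho' A B : (rho' <= rho)%R -> A `<=` B ->
  hausdorff_content f rho A <= hausdorff_content f rho' B.
Proof.
move=> rr AB; apply: ereal_inf_le_tmp => _ [C BC <-]; exists C => //.
exact: rho_coverS BC.
Qed.

(** The content grows as [rho] decreases, so the limit at 0 is a supremum. *)
Lemma hausdorffE F : hausdorff f F =
  ereal_sup (hausdorff_content f ^~ F @` [set rho | (0 < rho)%R]).
Proof.
have ni : {in `]0%R, +oo[ &, nonincreasing_fun (hausdorff_content f ^~ F)}.
  by move=> r s _ _ rs; exact: le_hausdorff_content.
have := @nonincreasing_at_right_cvge R _ 0%R (BInfty _ false) isT ni.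
rewrite /hausdorff => /cvg_lim -> //; congr (ereal_sup (_ @` _)).
by apply/seteqP; split=> r /=; rewrite in_itv/= andbT.
Qed.

Lemma hausdorff_content_le rho F : (0 < rho)%R ->
  hausdorff_content f rho F <= hausdorff f F.
Proof. by move=> rho0; rewrite hausdorffE; apply: ereal_sup_ubound;
  exists rho. Qed.

Lemma hausdorff_le rho0 F (M : \bar R) : (0 < rho0)%R ->
  (forall rho, (0 < rho < rho0)%R -> hausdorff_content f rho F <= M) ->
  hausdorff f F <= M.
Proof.
move=> rho00 FM; rewrite hausdorffE; apply: ge_ereal_sup => _ [rho /= r0 <-].
apply: (@le_trans _ _ (hausdorff_content f (Order.min rho (rho0 / 2)%R) F)).
  by apply: le_hausdorff_content => //; rewrite ge_min lexx.
by apply: FM; rewrite lt_min r0 gt_min divr_gt0//= orbC ltr_pdivrMr// ltr_pMr//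
  ltr1n.
Qed.

Lemma hausdorff_ge0 F : 0 <= hausdorff f F.
Proof. exact: le_trans (hausdorff_content_ge0 1 F) (hausdorff_content_le _ _).
Qed.

Lemma le_hausdorff A B : A `<=` B -> hausdorff f A <= hausdorff f B.
Proof.
move=> AB; apply: (@hausdorff_le 1%R) => // rho /andP[rho0 _].
exact: le_trans (le_hausdorff_content _ AB) (hausdorff_content_le _ _).
Qed.

Lemma hausdorff_content_cover rho F (M : R) : (0 < rho)%R ->
  hausdorff f F < M%:E ->
  exists2 C, rho_cover rho F C & \esum_(b in C) (f b.2)%:E < M%:E.
Proof.
move=> rho0 FM.
have /ereal_inf_lt[_ [C FC <-] CM] :=
  le_lt_trans (hausdorff_content_le F rho0) FM.
by exists C.
Qed.

Lemma hausdorff_fin_cover rho F : (0 < rho)%R -> hausdorff f F < +oo ->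
  exists C, rho_cover rho F C.
Proof.
move=> rho0 FM.
by have /ereal_inf_lt[_ [C FC <-] _] :=
  le_lt_trans (hausdorff_content_le F rho0) FM; exists C.
Qed.

Lemma hausdorff_content_bigcup {I : choiceType} (D : set I) (A : I ->
  set X) rho :
  countable D ->
  hausdorff_content f rho (\bigcup_(i in D) A i) <=
  \esum_(i in D) hausdorff_content f rho (A i).
Proof.
move=> cD; have [->|] :=
  eqVneq (\esum_(i in D) hausdorff_content f rho (A i)) +oo.
  exact: leey.
move=> Soo; have Afin i : D i -> hausdorff_content f rho (A i) \is a fin_num.
  move=> Di; rewrite ge0_fin_numE ?hausdorff_content_ge0//.
  rewrite ltey; apply: contra Soo => /eqP Aoo; rewrite -leye_eq -Aoo.
  by apply: (@esum_ge_elt _ _ D (fun i => hausdorff_content f rho (A i))) =>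
    //; exact: hausdorff_content_ge0.
have [phi phiI] := @countable_injP _ _ cD.
apply/lee_addgt0Pr => e e0.
(* [phi] injects [D] into the naturals, so these errors add up to at most [e]. *)
pose eps i := (e / (2 ^ (phi i).+1)%:R)%R.
have eps0 i : (0 < eps i)%R by rewrite divr_gt0// ltr0n expn_gt0.
have /choice[C CP] i : exists C, D i -> rho_cover rho (A i) C /\
    \esum_(b in C) (f b.2)%:E <= hausdorff_content f rho (A i) + (eps i)%:E.
  have [Di|nDi] := pselect (D i); last by exists set0.
  have [_ [C AC <-] Ce] := lb_ereal_inf_adherent (eps0 i) (Afin i Di).
  by exists C => _; split=> //; exact: ltW.
apply: (@le_trans _ _ (\esum_(b in \bigcup_(i in D) C i) (f b.2)%:E)).
  apply: ereal_inf_lbound; exists (\bigcup_(i in D) C i) => //; split.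
  - by apply: bigcup_countable => // i Di; case: (CP i Di).1.
  - by move=> b [i Di Cib]; case: (CP i Di) => -[_ + _] _; apply.
  - move=> x [i Di Aix]; have [[_ _ /(_ _ Aix)[b Cb bx]] _] := CP i Di.
    by exists b => //; exists i.
apply: le_trans.
  apply: esum_bigcup_le => i b Di Cb; exact: rho_cover_ge0 (CP i Di).1 Cb.
apply: (@le_trans _ _ (\esum_(i in D) (hausdorff_content f rho (A i) + (eps
  i)%:E))).
  by apply: le_esum => i Di; exact: (CP i Di).2.
rewrite esumD; last 2 first.
- by move=> i _; exact: hausdorff_content_ge0.
- by move=> i _; rewrite lee_fin ltW.
rewrite leeD2l//.
rewrite -(@esum_image _ _ _ D phi (fun n => (e / (2 ^ n.+1)%:R)%:E))//.
apply: le_trans (epsilon_trick0 xpredT (ltW e0)).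
rewrite nneseries_esumT; last by move=> n; rewrite lee_fin divr_ge0// ltW.
exact: subset_esum.
Qed.

Lemma hausdorff_bigcup {I : choiceType} (D : set I) (A : I -> set X) :
  countable D ->
  hausdorff f (\bigcup_(i in D) A i) <= \esum_(i in D) hausdorff f (A i).
Proof.
move=> cD; apply: (@hausdorff_le 1%R) => // rho /andP[rho0 _].
apply: le_trans (hausdorff_content_bigcup _ _ cD) _.
by apply: le_esum => i _; exact: hausdorff_content_le.
Qed.

Lemma hausdorffU A B : hausdorff f (A `|` B) <= hausdorff f A + hausdorff f B.
Proof.
have := @hausdorff_bigcup _ [set: bool] (fun b =>
  if b then A else B) (countableP _).
have -> : \bigcup_(b in [set: bool]) (if b then A else B) = A `|` B.
  apply/seteqP; split=> x; first by move=> [[] _]; [left|right].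
  by move=> [Ax|Bx]; [exists true|exists false].
move/le_trans; apply.
have -> : [set: bool] = [set true] `|` [set false].
  by apply/seteqP; split=> // -[] _; [left|right].
rewrite (esumID [set true]); last by move=> i _; exact: hausdorff_ge0.
have -> : ([set true] `|` [set false]) `&` [set true] = [set true].
  by apply/seteqP; split=> [b [] //|_ ->]; split=> //; left.
have -> : ([set true] `|` [set false]) `&` ~` [set true] = [set false].
  by apply/seteqP; split=> [b [[]//]|_ ->]; split=> //; right.
by rewrite !esum_set1//; exact: hausdorff_ge0.
Qed.

Lemma hausdorff_null_bigcup {I : choiceType} (D : set I) (A : I -> set X) :
  countable D -> (forall i, D i -> hausdorff f (A i) = 0) ->
  hausdorff f (\bigcup_(i in D) A i) = 0.
Proof.
move=> cD A0; apply/eqP; rewrite eq_le hausdorff_ge0 andbT.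
by rewrite (le_trans (hausdorff_bigcup _ cD))// esum1.
Qed.

Lemma hausdorff0 : hausdorff f (set0 : set X) = 0.
Proof.
by rewrite -(bigcup_set0 (fun _ : nat => (set0 : set X))) hausdorff_null_bigcup.
Qed.

(** A ball of radius below [d / 2] cannot meet both sets, so every fine cover of the union splits
    into a cover of [A] and one of [B]. *)
Lemma hausdorffU_separated A B (d : R) : (0 < d)%R ->
  (forall x y, A x -> B y -> (d <= mdist x y)%R) ->
  hausdorff f A + hausdorff f B <= hausdorff f (A `|` B).
Proof.
move=> d0 sepAB.
have ABrho rho : (0 < rho < d / 2)%R ->
    hausdorff_content f rho A + hausdorff_content f rho B <= hausdorff f (A `|`
      B).
  move=> /andP[rho0 rhod]; apply: le_trans (hausdorff_content_le _ rho0).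
  apply: le_ereal_inf_tmp => _ [C ABC <-].
  have [cC rC sC] := ABC.
  have C0 b : C b -> 0 <= (f b.2)%:E by move=> Cb; apply: rho_cover_ge0 ABC Cb.
  pose K := [set b : X * R | exists2 x, A x & ball b.1 b.2 x].
  rewrite (esumID K)//; apply: leeD.
    apply: ereal_inf_lbound; exists (C `&` K) => //; split.
    - apply: (sub_countable _ cC); apply: subset_card_le; exact: subIsetl.
    - by move=> b [/rC].
    - move=> x Ax; have [|b Cb bx] := sC x; first by left.
      by exists b => //; split=> //; exists x.
  apply: ereal_inf_lbound; exists (C `&` ~` K) => //; split.
  - apply: (sub_countable _ cC); apply: subset_card_le; exact: subIsetl.
  - by move=> b [/rC].
  - move=> y By; have [|b Cb by_] := sC y; first by right.
    exists b => //; split=> // -[x Ax bx].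
    have := sepAB _ _ Ax By; have := metric_triangle x b.1 y.
    move: bx by_ => /ballP + /ballP; rewrite (metric_sym x b.1).
    have /andP[_ ] := rC _ Cb; lra.
rewrite [X in X + _]hausdorffE.
have [->|ABoo] := eqVneq (hausdorff f (A `|` B)) +oo; first exact: leey.
have Bfin : hausdorff f B \is a fin_num.
  rewrite ge0_fin_numE ?hausdorff_ge0//;
    apply: (@le_lt_trans _ _ (hausdorff f (A `|` B))).
    by apply: le_hausdorff; exact: subsetUr.
  by rewrite ltey.
rewrite -leeBrDr//; apply: ge_ereal_sup => _ [rho /= rho0 <-].
rewrite leeBrDr// addeC -leeBrDr; last first.
  rewrite ge0_fin_numE ?hausdorff_content_ge0//.
  apply: (le_lt_trans (hausdorff_content_le _ rho0)).
  apply: (@le_lt_trans _ _ (hausdorff f (A `|` B))); last by rewrite ltey.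
  by apply: le_hausdorff; exact: subsetUl.
(* The scale [rho] is fixed for [A]; passing to the smaller scale [rho'] used for [B] only increases
   the content of [A]. *)
apply: (@hausdorff_le (Order.min rho (d / 2)%R));
  first by rewrite lt_min rho0 divr_gt0.
move=> rho' /andP[rho'0]; rewrite lt_min => /andP[rr rd].
rewrite leeBrDr; last first.
  rewrite ge0_fin_numE ?hausdorff_content_ge0//.
  apply: (le_lt_trans (hausdorff_content_le _ rho0)).
  apply: (@le_lt_trans _ _ (hausdorff f (A `|` B))); last by rewrite ltey.
  by apply: le_hausdorff; exact: subsetUl.
apply: le_trans (ABrho rho' _); last by rewrite rho'0.
by rewrite addeC leeD2r// le_hausdorff_content// ltW.
Qed.

(** Finite superadditivity without measurability: by induction, the smallest gap between the head
    and the other sets separates it from their union. *)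
Lemma hausdorff_separated_sum {I : eqType} (s : seq I) (A : I -> set X) W :
  uniq s -> (forall i, i \in s -> A i `<=` W) ->
  (forall i j, i \in s -> j \in s -> i != j -> exists2 d : R, (0 < d)%R &
    forall x y, A i x -> A j y -> (d <= mdist x y)%R) ->
  \sum_(i <- s) hausdorff f (A i) <= hausdorff f W.
Proof.
move=> us sW sep; apply:
  (@le_trans _ _ (hausdorff f (\bigcup_(i in [set` s]) A i))); last first.
  by apply: le_hausdorff => x [i /= /sW]; exact.
elim: s us {sW} sep => [|i s IHs] /=; first by rewrite big_nil hausdorff_ge0.
move=> /andP[ni us] sep; rewrite big_cons.
have [d d0 dP] : exists2 d : R, (0 < d)%R & forall j, j \in s ->
    forall x y, A i x -> A j y -> (d <= mdist x y)%R.
  apply: (common_pos_witness (P := fun j d => forall x y, A i x -> A j y ->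
      (d <= mdist x y)%R)) => [j d d' /andP[_ dd] Aij x y Ax Ay|j js].
    exact: le_trans dd (Aij _ _ Ax Ay).
  apply: sep; rewrite ?inE ?eqxx ?js ?orbT//.
  by apply: contraNneq ni => ->.
have -> : \bigcup_(j in [set` i ::
  s]) A j = A i `|` \bigcup_(j in [set` s]) A j.
  apply/seteqP; split=> x.
    by move=> [j /= /[!inE] /orP[/eqP->|js] Ajx]; [left|right; exists j].
  move=> [Aix|[j js Ajx]]; first by exists i => //=; rewrite mem_head.
  by exists j => //=; rewrite inE; apply/orP; right.
apply: le_trans (@hausdorffU_separated _ _ d d0 _).
  rewrite leeD2l// IHs// => j k js ks; apply: sep; rewrite inE ?js ?ks orbT//.
by move=> x y Ax [j /= js Ay]; exact: (dP j).
Qed.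

End hausdorff_measure.

Lemma hausdorff_null_le {R : realType} {X : metricType R} (f g : R -> R)
    (L d : R) (E : set X) :
  (forall x, 0 <= x -> 0 <= g x) -> (forall x, 0 <= x -> 0 <= f x) ->
  0 <= L -> 0 < d -> (forall x, 0 < x < d -> f x <= L * g x) ->
  hausdorff g E = 0%E -> hausdorff f E = 0%E.
Proof.
move=> g0 f0 L0 d0 fg E0; apply/eqP; rewrite eq_le hausdorff_ge0// andbT.
apply: (hausdorff_le d0) => rho /andP[rho0 rhod].
apply/lee_addgt0Pr => e e0; rewrite add0e.
(* Dividing by [L + 1] rather than [L] covers the case [L = 0]. *)
have [|C EC Ce] := @hausdorff_content_cover _ _ g rho E (e / (L + 1)) rho0.
  by rewrite E0 lte_fin divr_gt0// ltr_wpDl.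
apply: ereal_inf_le; exists (\esum_(b in C) (f b.2)%:E)%E; first by exists C.
apply: (@le_trans _ _ (\esum_(b in C) (L%:E * (g b.2)%:E))%E).
  have [_ rC _] := EC.
  apply: le_esum => b /rC/andP[b0 br]; rewrite -EFinM lee_fin fg// b0//.
  exact: lt_trans br rhod.
apply: le_trans (esumZl_le L0 _) _; first by move=> b; exact: rho_cover_ge0 EC.
apply: (@le_trans _ _ (L%:E * (e / (L + 1))%:E)%E).
  by rewrite lee_wpmul2l ?lee_fin// ltW.
rewrite -EFinM lee_fin mulrA ler_pdivrMr; last by rewrite ltr_wpDl.
by rewrite mulrC ler_pM2l// lerDl.
Qed.

(** * Vitali coverings *)

Section vitali.
Context {R : realType} {X : metricType R}.
Implicit Types (p q : X * R) (V D : set (X * R)).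

Let B p := ball p.1 p.2.

(* Maximality is taken among the disjoint subfamilies D such that every ball
   of V meeting D meets a ball of D of at least half its radius. *)
Lemma vitali_5r V (delta : R) : (forall p, V p -> 0 < p.2 <= delta) ->
  exists D, [/\ D `<=` V, trivIset D (fun p => ball p.1 p.2) &
    forall p, V p -> exists2 q, D q & ball p.1 p.2 `<=` ball q.1 (5 * q.2)].
Proof.
move=> Vr.
pose big D p := exists q, [/\ D q, B p `&` B q !=set0 & p.2 <= 2 * q.2].
pose P D := [/\ D `<=` V, trivIset D B & forall p q, V p -> D q ->
  B p `&` B q !=set0 -> big D p].
have [F FP tF|D [[DV tD Dbig] maxD]] := @Zorn_bigcup _ P.
  split.
  - by move=> p [D FD Dp]; have [DV _ _] := FP _ FD; exact: DV.
  - move=> p q [D FD Dp] [E FE Eq] pq; have [DE|ED] := tF _ _ FD FE.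
      by have [_ tE _] := FP _ FE; apply: tE => //; exact: DE.
    by have [_ tD _] := FP _ FD; apply: tD => //; exact: ED.
  - move=> p q Vp [D FD Dq] pq; have [_ _ Dbig] := FP _ FD.
    have [q' [Dq' pq' le]] := Dbig _ _ Vp Dq pq.
    by exists q'; split=> //; exists D.
exists D; split=> // p Vp.
suff [q [Dq [x [/ballP px /ballP qx]] pq]] : big D p.
  (* As [p.2 <= 2 * q.2], the ball [p] stays within [q.2 + 2 * p.2 <= 5 * q.2] of the center of
     [q]. *)
  exists q => //; apply: ball_subset.
  have := metric_triangle q.1 x p.1; rewrite (metric_sym x p.1); lra.
apply: contrapT => nbig.
(* [W] collects the balls of [V] that miss [D]. Adding to [D] one whose radius exceeds half the
   supremum of their radii contradicts maximality. *)
pose W := [set q | V q /\ forall q', D q' -> ~ (B q `&` B q' !=set0)].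
have Wp : W p by split=> // q Dq pq; apply: nbig; exact: Dbig Dq pq.
pose S := [set q.2 | q in W].
have supS : has_sup S.
  by split; [exists p.2, p|exists delta => _ [q [/Vr/andP[_ +] _] <-]].
have p0 : 0 < p.2 by have /andP[] := Vr _ Vp.
have S0 : 0 < sup S by apply: lt_le_trans p0 _; apply: (sup_upper_bound supS);
  exists p.
have [|_ [q Wq <-] Sq] := @sup_adherent _ S (sup S / 2) _ supS;
  first by rewrite divr_gt0.
have maxq q' : W q' -> q'.2 <= 2 * q.2.
  move=> Wq'; have : q'.2 <= sup S by apply: (sup_upper_bound supS); exists q'.
  lra.
have q0 : 0 < q.2 by have /andP[] := Vr _ Wq.1.
have Bqq : B q `&` B q !=set0.
  by exists q.1; split; apply/ballP; rewrite mdistxx.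
apply: (maxD (q |` D)).
  split; first by move=> q' Dq'; right.
  by move=> /(_ q (or_introl erefl)) Dq; exact: (Wq.2 _ Dq).
split.
- by move=> _ [->|/DV//]; exact: Wq.1.
- move=> u v [->|Du] [->|Dv] uv //; last exact: tD.
    by case: (Wq.2 _ Dv uv).
  by rewrite setIC in uv; case: (Wq.2 _ Du uv).
- move=> u v Vu Dv uv.
  have [[w [Dw uw]]|nu] := pselect (exists w, D w /\ B u `&` B w !=set0).
    have [w' [Dw' uw' le]] := Dbig _ _ Vu Dw uw.
    by exists w'; split=> //; right.
  exists q; split; first by left.
    by case: Dv uv => [->//|Dv] uv; case: nu; exists v.
  by apply: maxq; split=> // w Dw uw; apply: nu; exists w.
Qed.

(** Stands in for separability: each ball contains the center of a member of countably many fine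
    covers of [A], and disjointness makes the choice injective. *)
Lemma countable_disjoint_balls D (A : set X) :
  (forall rho, 0 < rho -> exists C, rho_cover rho A C) ->
  trivIset D (fun p => ball p.1 p.2) ->
  (forall p, D p -> A `&` ball p.1 p.2 !=set0) -> countable D.
Proof.
move=> Acov tD DA.
have /choice[C CP] (n : nat) : exists C, rho_cover (n.+1%:R^-1 : R) A C.
  by apply: Acov; rewrite invr_gt0 ltr0n.
have cC : countable (\bigcup_n C n).
  by apply: bigcup_countable => // n _; case: (CP n).
have /countable_injP[phi phiI] := cC.
have /choice[b bP] p : exists b, D p -> (\bigcup_n C n) b /\ ball p.1 p.2 b.1.
  have [Dp|nDp] := pselect (D p); last by exists p.
  have [x [Ax /ballP px]] := DA _ Dp.
  have [n nP] : exists n : nat, (n.+1%:R^-1 : R) < p.2 - mdist p.1 x.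
    have d0 : 0 < p.2 - mdist p.1 x by rewrite subr_gt0.
    have [n _ nP] := near_infty_natSinv_lt (PosNum d0).
    by exists n; exact: (nP n (leqnn n)).
  have [_ rC sC] := CP n; have [c Cc /ballP cx] := sC _ Ax.
  exists c => _; split; first by exists n.
  apply/ballP; have /andP[_ cn] := rC _ Cc.
  have := metric_triangle p.1 x c.1; rewrite (metric_sym x c.1).
  move: cx nP cn; set h := (_ ^-1); lra.
apply/countable_injP; exists (phi \o b) => p q; rewrite !inE => Dp Dq /= pq.
apply: tD => //; exists (b p).1; split; first by case: (bP p Dp).
have [Cp _] := bP p Dp; have [Cq bq] := bP q Dq.
by rewrite (phiI (b p) (b q))// inE.
Qed.

End vitali.

(** * Doubling gauges and Ahlfors regular Hausdorff measures *)

Record doubling_gauge {R : realType} (g : R -> R) (lam : R) : Prop := {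
  gauge_ge0 : forall x, 0 <= x -> 0 <= g x;
  gauge_nd : forall x y, 0 <= x -> x <= y -> g x <= g y;
  gauge_lam_gt1 : 1 < lam;
  gauge_dbl : forall x, 0 < x -> g (2 * x) < lam * g x }.

Record ahlfors {R : realType} (X : metricType R) (g : R -> R)
    (lam c1 c2 r0 : R) : Prop := {
  ahlfors_gauge : doubling_gauge g lam;
  ahlfors_c1_gt0 : 0 < c1;
  ahlfors_c2_gt0 : 0 < c2;
  ahlfors_r0_gt0 : 0 < r0;
  ahlfors_lb : forall (x : X) r, 0 < r < r0 ->
    ((c1 * g r)%:E <= hausdorff g (ball x r))%E;
  ahlfors_ub : forall (x : X) r, 0 < r < r0 ->
    (hausdorff g (ball x r) <= (c2 * g r)%:E)%E }.

Section doubling_gauge_theory.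
Context {R : realType} (g : R -> R) (lam : R).
Hypothesis gG : doubling_gauge g lam.

Let g_ge0 := gauge_ge0 gG.
Let g_nd := gauge_nd gG.
Let lam_gt1 := gauge_lam_gt1 gG.
Let g_dbl := gauge_dbl gG.

Lemma gauge_lam_gt0 : 0 < lam. Proof. exact: lt_trans ltr01 lam_gt1. Qed.

(** If [g x] vanished, strict doubling would make [g (2 * x)] negative. *)
Lemma doubling_gt0 x : 0 < x -> 0 < g x.
Proof.
move=> x0; have := g_dbl x0; have := @g_nd x (2 * x) (ltW x0).
have := g_ge0 (ltW x0) => gx0 gx2 gd.
have : g x <= g (2 * x) by apply: gx2; lra.
rewrite lt0r gx0 andbT; move=> gx; apply/eqP => gxE; move: gd gx; rewrite gxE;
  lra.
Qed.

Lemma doubling_iter n x : 0 < x -> g (2 ^+ n * x) <= lam ^+ n * g x.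
Proof.
move=> x0; elim: n => [|n IHn]; first by rewrite !expr0 !mul1r.
rewrite !exprS -!mulrA.
have : g (2 * (2 ^+ n * x)) < lam * g (2 ^+ n * x).
  by apply: g_dbl; rewrite mulr_gt0// exprn_gt0.
move/ltW/le_trans; apply; rewrite ler_pM2l ?(lt_trans ltr01)//; exact: IHn.
Qed.

Lemma doubling_le n k x : 0 < x -> 0 <= k -> k <= 2 ^+ n ->
  g (k * x) <= lam ^+ n * g x.
Proof.
move=> x0 k0 kn; apply: le_trans (doubling_iter n x0).
by apply: g_nd; [rewrite mulr_ge0// ltW|rewrite ler_pM2r].
Qed.

Lemma doubling_half x : 0 < x -> g x / lam <= g (x / 2).
Proof.
move=> x0; rewrite ler_pdivrMr ?gauge_lam_gt0//.
have := g_dbl (divr_gt0 x0 (ltr0n R 2)).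
by rewrite mulrC divfK ?pnatr_eq0// [g _ * _]mulrC; exact: ltW.
Qed.

End doubling_gauge_theory.

Section ahlfors_theory.
Context {R : realType} {X : metricType R} (g : R -> R) (lam c1 c2 r0 : R).
Hypothesis gA : ahlfors X g lam c1 c2 r0.

Let gG := ahlfors_gauge gA.
Let g_ge0 := gauge_ge0 gG.
Let c2_gt0 := ahlfors_c2_gt0 gA.
Let g_ub := ahlfors_ub gA.

Lemma hausdorff_ball_fin (x : X) r : r < r0 -> (hausdorff g (ball x r) < +oo)%E.
Proof.
move=> rr0; have [r_gt0|r_le0] := ltP 0 r.
  by apply: le_lt_trans (g_ub x _) _; rewrite ?r_gt0// ltry.
rewrite (_ : ball x r = set0); last first.
  by apply/seteqP; split=> // y /ballP xy; have := mdist_ge0 x y; lra.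
by rewrite hausdorff0// ltry.
Qed.

(** The fivefold enlargements of a disjoint subfamily cover [A], and [5 <= 2 ^ 3] explains
    [lam ^+ 3]. Balls missing [A] are discarded first, to obtain countability. *)
Lemma vitali_hausdorff (A : set X) (V : set (X * R)) delta :
  5 * delta < r0 -> (hausdorff g A < +oo)%E ->
  (forall p, V p -> 0 < p.2 <= delta) ->
  (forall x, A x -> exists2 p, V p & ball p.1 p.2 x) ->
  exists D, [/\ D `<=` V, countable D, trivIset D (fun p => ball p.1 p.2) &
    (hausdorff g A <= \esum_(p in D) (c2 * lam ^+ 3 * g p.2)%:E)%E].
Proof.
move=> dr0 Aoo Vr AV.
pose W := [set p | V p /\ A `&` ball p.1 p.2 !=set0].
have [|D [DW tD WD]] := @vitali_5r R X W delta; first by move=> p [/Vr].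
have cD : countable D.
  apply: (@countable_disjoint_balls _ _ D A) => //.
    by move=> rho rho0; exact: hausdorff_fin_cover Aoo.
  by move=> p /DW[].
exists D; split=> //; first by move=> p /DW[].
apply: (@le_trans _ _ (hausdorff g (\bigcup_(p in D) ball p.1 (5 * p.2)))).
  apply: le_hausdorff => // x Ax; have [p Vp px] := AV _ Ax.
  have [|q Dq pq] := WD p; first by split=> //; exists x.
  by exists q => //; exact: pq.
apply: le_trans (hausdorff_bigcup g_ge0 _ cD) _;
  apply: le_esum => p /DW[/Vr/andP[p0 pd] _].
apply: le_trans (g_ub _ _) _; first by apply/andP; split; lra.
rewrite lee_fin -mulrA ler_pM2l//; apply: (doubling_le gG) => //.
by rewrite (_ : 2 ^+ 3 = 8 :> R)//; [lra|rewrite !exprS expr0; lra].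
Qed.

End ahlfors_theory.

(** * The case where f / g is bounded near 0 *)

Definition tail_nbhood {R : realType} {X : metricType R} (F : nat -> set X)
    (U : nat -> R) (n : nat) : set X :=
  \bigcup_(j in [set j | (n <= j)%N]) nbhood (F j) (U j).

Lemma limsup_nbhoodE {R : realType} {X : metricType R} (F : nat -> set X)
    (U : nat -> R) : limsup_nbhood F U = \bigcap_n tail_nbhood F U n.
Proof.
apply/seteqP; split=> x.
  move=> xinf n _; apply: contrapT => xn; apply: xinf.
  apply: (@sub_finite_set _ _ `I_n); last exact: finite_II.
  move=> j xj /=; rewrite ltnNge; apply/negP => nj; apply: xn; exists j => //.
move=> xn; rewrite /limsup_nbhood/= => /finite_seqP[s sE].
have [j /= nj xj] := xn (\max_(i <- s) i).+1 I.
have js : j \in s by have : [set` s] j by rewrite -sE.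
by move: nj; rewrite ltnNge leq_bigmax_seq.
Qed.

(** Points of [inner S e] are at distance at least [e] from the complement of [S], which is the
    separation that superadditivity requires. *)
Definition inner {R : realType} {X : metricType R} (S : set X) (e : R) :
  set X :=
  [set x | ball x e `<=` S].

Section bounded_ratio.
Context {R : realType} {X : metricType R}.
Variables (g : R -> R) (lam c1 c2 r0 : R).
Hypothesis gA : ahlfors X g lam c1 c2 r0.

Let gG := ahlfors_gauge gA.
Let g_ge0 := gauge_ge0 gG.
Let lam_gt0 := gauge_lam_gt0 gG.
Let c1_gt0 := ahlfors_c1_gt0 gA.
Let c2_gt0 := ahlfors_c2_gt0 gA.
Let r0_gt0 := ahlfors_r0_gt0 gA.
Let g_lb := ahlfors_lb gA.
Let g_gt0 := doubling_gt0 gG.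
Let g_half := doubling_half gG.
Let K := c2 * lam ^+ 3.
Let K_gt0 : 0 < K. Proof. by rewrite mulr_gt0// exprn_gt0. Qed.

(** A Vitali covering yields disjoint balls. A finite subfamily keeps half of the bound, whence the
    factor 2, and admits a common [e]. The concentric half balls are separated, so their masses add
    up. *)
Lemma packing_inner (S A W : set X) (delta c a : R) :
  5 * delta < r0 -> (hausdorff g A < +oo)%E -> 0 < c -> 0 < a ->
  (a%:E <= hausdorff g A)%E ->
  (forall x, A x -> exists y T, [/\ 0 < T <= delta, ball y T x,
    ball y T `<=` W & exists2 e, 0 < e &
      ((c * g T)%:E <= hausdorff g (ball y (T / 2) `&` inner S e))%E]) ->
  exists2 e, 0 < e &
    ((c / (2 * K) * a)%:E <= hausdorff g (W `&` inner S e))%E.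
Proof.
move=> dr0 Aoo c0 a0 aA AW.
pose V := [set p : X * R | [/\ 0 < p.2 <= delta, ball p.1 p.2 `<=` W &
  exists2 e, 0 < e &
      ((c * g p.2)%:E <= hausdorff g (ball p.1 (p.2 / 2) `&` inner S e))%E]].
have [||D [DV cD tD AD]] :=
  @vitali_hausdorff _ _ _ _ _ _ _ gA A V delta dr0 Aoo.
- by move=> p [].
- by move=> x /AW[y [T [? ? ? ?]]]; exists (y, T).
have : ((a / 2)%:E < \esum_(p in D) (K * g p.2)%:E)%E.
  apply: lt_le_trans AD; apply: lt_le_trans aA; rewrite lte_fin; lra.
move=> /ereal_sup_gt[_ [Y [/finite_seqP[s YE] YD] <-]].
have {YE} YE : Y = [set` undup s].
  by rewrite YE; apply/seteqP; split=> p /=; rewrite mem_undup.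
have : uniq (undup s) by exact: undup_uniq.
move: (undup s) YE => l YE ul; rewrite {}YE in YD *; rewrite -fsbig_seq// => al.
have [||e e0 eP] := @common_pos_witness R _ l (fun p e =>
  ((c * g p.2)%:E <= hausdorff g (ball p.1 (p.2 / 2) `&` inner S e))%E).
- move=> p d d' /andP[d'0 dd] /le_trans; apply;
  apply: le_hausdorff => // x [Bx Sx].
  split=> //; by apply: subset_trans Sx; exact: le_ball.
- by move=> p /YD /DV[].
exists e => //.
apply: (@le_trans _ _ (\sum_(p <- l) hausdorff g (ball p.1 (p.2 / 2) `&` inner
  S e))%E).
  apply: (@le_trans _ _ (\sum_(p <- l) (c * g p.2)%:E)%E); last first.
    by rewrite big_seq [leRHS]big_seq; apply: lee_sum => p /eP.
  move: al; rewrite !sumEFin lte_fin lee_fin -!mulr_sumr => al.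
  have -> : c / (2 * K) * a = c * (a / 2 / K).
    by field; rewrite gt_eqF.
  by rewrite ler_pM2l// ler_pdivrMr// [leRHS]mulrC ltW.
apply: hausdorff_separated_sum => //.
  move=> p /YD /DV[/andP[p0 _] pW _] x [Bx Sx]; split=> //; apply: pW.
  by apply: le_ball Bx; lra.
move=> p q /YD Dp /YD Dq pq.
have [/andP[p0 _] _ _] := DV _ Dp; have [/andP[q0 _] _ _] := DV _ Dq.
(* A point of the half ball of [q] closer than this to the half ball of [p] would lie in both
   disjoint balls. *)
exists (p.2 / 2); first by rewrite divr_gt0.
move=> x y [/ballP px _] [/ballP qy _]; rewrite leNgt; apply/negP => xy.
move/eqP: pq; apply; apply: tD => //; exists y; split; apply/ballP.
  have := metric_triangle p.1 x y; lra.
lra.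
Qed.

Section fat.
Variables (F : nat -> set X) (U : nat -> R) (Lg : set X) (M : R).
Hypothesis M_gt0 : 0 < M.
Hypothesis Lg_full : forall (x : X) r, 0 < r ->
  hausdorff g (ball x r `&` Lg) = hausdorff g (ball x r).
Hypothesis Lg_hit : forall (x : X) (n : nat) (delta : R), Lg x -> 0 < delta ->
  exists j y T, [/\ (n <= j)%N, F j y, mdist x y < T < delta, 0 < U j <= T &
    g T <= M * g (U j)].

Let G := tail_nbhood F U.

(** Points of [Lg] in the half ball lie in balls of radius [T] about points [y] of some [F j], and
    the ball of radius [U j / 2] about [y] has mass at least a fixed multiple of [g T]. The constant
    depends neither on [n] nor on the ball. *)
Lemma ball_inner_tail : exists2 c : R, 0 < c & forall n (x : X) t, 0 < t < r0 ->
  exists2 e, 0 < e & ((c * g t)%:E <= hausdorff g (ball x t `&` inner (G n)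
    e))%E.
Proof.
pose c' := c1 / (lam * M).
have c'0 : 0 < c' by rewrite divr_gt0// mulr_gt0.
exists (c' / (2 * K) * (c1 / lam)).
  by rewrite mulr_gt0 ?divr_gt0 ?mulr_gt0.
move=> n x t /andP[t0 tr0].
(* The bound [t / 4] keeps the balls inside [ball x t], and [r0 / 10] keeps their enlargements below
   [r0]. *)
have [||||||e e0 eP] := @packing_inner (G n) (ball x (t / 2) `&` Lg) (ball x t)
   (Order.min (t / 4) (r0 / 10)) c' (c1 / lam * g t).
- have : Order.min (t / 4) (r0 / 10) <= r0 / 10 by rewrite ge_min lexx orbT.
  have := r0_gt0; lra.
- apply: le_lt_trans (@hausdorff_ball_fin _ _ _ _ _ _ _ gA x (t / 2) _);
  last by lra.
  by apply: le_hausdorff; exact: subIsetl.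
- exact: c'0.
- by rewrite mulr_gt0 ?divr_gt0 ?g_gt0.
- rewrite Lg_full ?divr_gt0//; apply: le_trans (g_lb x _); last first.
    by rewrite divr_gt0//=; lra.
  by rewrite lee_fin mulrAC -mulrA ler_pM2l// g_half.
- move=> z [/ballP xz Lz].
  have m0 : 0 < Order.min (t / 4) (r0 / 10) by rewrite lt_min !divr_gt0.
  have [j [y [T [nj Fy /andP[zy Tm] /andP[U0 UT] gT]]]] := Lg_hit n Lz m0.
  have Tt : T < t / 4 by apply: lt_le_trans Tm _; rewrite ge_min lexx.
  exists y, T; split.
  + by rewrite (ltW Tm) andbT; exact: lt_le_trans UT.
  + by apply/ballP; rewrite metric_sym.
  + apply: ball_subset; have := metric_triangle x z y; lra.
  (* Points of [ball y (U j / 2)] have their ball of radius [U j / 2] inside the neighbourhood of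
     [F j] of radius [U j]. *)
  exists (U j / 2); first by rewrite divr_gt0.
  apply: (@le_trans _ _ (hausdorff g (ball y (U j / 2)))); last first.
    apply: le_hausdorff => // w yw; split; first by apply: le_ball yw; lra.
    move=> v /ballP wv; exists j => //; apply/nbhoodP; exists y => //.
    move/ballP : yw; have := metric_triangle v w y.
    by rewrite (metric_sym v w) (metric_sym w y); lra.
  apply: le_trans (g_lb y _); last first.
    have : T < r0 / 10 by apply: lt_le_trans Tm _; rewrite ge_min lexx orbT.
    by rewrite divr_gt0//=; have := r0_gt0; lra.
  rewrite lee_fin /c' -mulrA ler_pM2l// mulrC ler_pdivrMr ?mulr_gt0//.
  apply: (le_trans gT); rewrite mulrC mulrA ler_pM2r//.
  by rewrite -ler_pdivrMr// g_half.
exists e => //; apply: le_trans eP.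
by rewrite lee_fin -[leLHS]mulrA.
Qed.

(** Small balls about the points of [V] satisfy [ball_inner_tail] on their half balls; packing them
    keeps [c] independent of [V] and [n]. *)
Lemma open_inner_tail : exists2 c : R, 0 < c & forall n (V : set X) (a : R),
  open V -> (hausdorff g V < +oo)%E -> 0 < a -> (a%:E <= hausdorff g V)%E ->
  exists2 e, 0 < e & ((c * a)%:E <= hausdorff g (V `&` inner (G n) e))%E.
Proof.
have [c c0 cP] := ball_inner_tail.
exists (c / lam / (2 * K)); first by rewrite !divr_gt0 ?mulr_gt0.
move=> n V a oV Voo a0 aV.
apply: (@packing_inner (G n) V V (r0 / 10) (c / lam) a) => //.
- have := r0_gt0; lra.
- by rewrite divr_gt0.
move=> x Vx; have [T0 T00 TV] := (open_ballP V).1 oV x Vx.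
pose T := Order.min T0 (r0 / 10).
have Tpos : 0 < T by rewrite lt_min T00 divr_gt0.
have Tr : T <= r0 / 10 by rewrite ge_min lexx orbT.
exists x, T; split.
- by rewrite Tpos.
- by apply/ballP; rewrite mdistxx.
- by apply: subset_trans TV; apply: le_ball; rewrite ge_min lexx.
have [|e e0 eP] := cP n x (T / 2).
  by rewrite divr_gt0//=; have := r0_gt0; lra.
exists e => //; apply: le_trans eP; rewrite lee_fin -mulrA ler_pM2l// mulrC.
exact: g_half.
Qed.

(** Let [m] be the infimum of the measures of open sets between [E] and the ball. If [m] is
    positive, an almost optimal [V] contains a set of mass at least [c * m] separated from a smaller
    neighbourhood of [E], itself of mass at least [m]; together they exceed the measure of [V]. *)
Lemma ball_setD_tail_null n (x : X) r : r < r0 ->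
  hausdorff g (ball x r `\` G n) = 0%E.
Proof.
move=> rr0; set E := _ `\` _.
have [c c0 cP] := open_inner_tail.
pose O := [set V | [/\ open V, E `<=` V & V `<=` ball x r]].
pose m := ereal_inf [set hausdorff g V | V in O].
have Em : (hausdorff g E <= m)%E.
  by apply: le_ereal_inf_tmp => _ [V [_ EV _] <-]; exact: le_hausdorff.
have m0 : (0 <= m)%E by apply: le_trans Em; exact: hausdorff_ge0.
have moo : (m < +oo)%E.
  apply: le_lt_trans (hausdorff_ball_fin gA x rr0); apply: ereal_inf_lbound.
  by exists (ball x r) => //; split; [exact: open_ball|exact: subDsetl|].
have mfin : m \is a fin_num by rewrite ge0_fin_numE.
apply/eqP; rewrite eq_le hausdorff_ge0// andbT; apply: (le_trans Em).
rewrite leNgt; apply/negP => m_gt0.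
have mE : m = (fine m)%:E by rewrite fineK.
have fm0 : 0 < fine m by rewrite -lte_fin -mE.
have [_ [V [oV EV Vr] <-] Vm] := lb_ereal_inf_adherent (mulr_gt0 c0 fm0) mfin.
have Voo : (hausdorff g V < +oo)%E.
  by apply: le_lt_trans (hausdorff_ball_fin gA x rr0); exact: le_hausdorff.
have mV : ((fine m)%:E <= hausdorff g V)%E.
  by rewrite -mE; apply: ereal_inf_lbound; exists V.
have [e e0 eP] := cP n V _ oV Voo fm0 mV.
pose V' := V `&` nbhood E (e / 2).
have mV' : (m <= hausdorff g V')%E.
  apply: ereal_inf_lbound; exists V' => //; split.
  - by apply: openI => //; exact: open_nbhood.
  - move=> z Ez; split; first exact: EV.
    by apply/nbhoodP; exists z => //; rewrite mdistxx divr_gt0.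
  - by move=> z [/Vr].
have : (m + (c * fine m)%:E <= hausdorff g V)%E.
  apply: (@le_trans _ _ (hausdorff g (V' `|` (V `&` inner (G n) e))));
    last first.
    by apply: le_hausdorff => // z [[]|[]].
  apply: le_trans (@hausdorffU_separated _ _ g g_ge0 _ _ (e / 2) _ _).
  - exact: leeD.
  - by rewrite divr_gt0.
  move=> u v [_ /nbhoodP[w [_ nGw] uw]] [_ vG]; rewrite leNgt; apply/negP => uv.
  apply: nGw; apply: vG; apply/ballP.
  have := metric_triangle v u w; rewrite (metric_sym v u); lra.
by rewrite leNgt Vm.
Qed.

Let La := limsup_nbhood F U.

Lemma ball_setD_limsup_null (x : X) r : r < r0 ->
  hausdorff g (ball x r `\` La) = 0%E.
Proof.
move=> rr0; have -> : ball x r `\` La = \bigcup_n (ball x r `\` G n).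
  by rewrite /La limsup_nbhoodE setDE setC_bigcap setI_bigcupr.
apply: (hausdorff_null_bigcup g_ge0 (countableP [set: nat])) => n _.
exact: ball_setD_tail_null.
Qed.

Lemma ball_limsup_neq0 (x : X) r : 0 < r < r0 -> ball x r `&` La !=set0.
Proof.
move=> /andP[r_gt0 rr0]; apply/set0P/negP => /eqP BL.
have : hausdorff g (ball x r) = 0%E.
  rewrite -(ball_setD_limsup_null x rr0); congr hausdorff.
  apply/seteqP; split=> [y xy|y []//]; split=> // Ly.
  by have : (ball x r `&` La) y by []; rewrite BL.
have : (0 < (c1 * g r)%:E)%E by rewrite lte_fin mulr_gt0// g_gt0.
by move=> /lt_le_trans/(_ (g_lb x _)); rewrite r_gt0 rr0 => /(_ isT) + H;
  rewrite H ltxx.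
Qed.

Lemma hausdorff_limsup_bounded_ratio (f : R -> R) (L d : R) :
  (forall x, 0 <= x -> 0 <= f x) ->
  0 <= L -> 0 < d -> (forall x, 0 < x < d -> f x <= L * g x) ->
  forall (x : X) r, 0 < r ->
    hausdorff f (ball x r `&` La) = hausdorff f (ball x r).
Proof.
move=> f0 L0 d0 fg x r r_gt0; apply/eqP; rewrite eq_le; apply/andP; split.
  by apply: le_hausdorff => //; exact: subIsetl.
have [->|BLoo] := eqVneq (hausdorff f (ball x r `&` La)) +oo%E;
  first exact: leey.
have {BLoo} BLoo : (hausdorff f (ball x r `&` La) < +oo)%E by rewrite ltey.
have [|C [cC rC sC]] := @hausdorff_fin_cover _ _ f (r0 / 3) _ _ BLoo.
  by rewrite divr_gt0.
(* The radius [r] may exceed [r0], so the ball is cut into small pieces. As [La] is dense, balls of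
   radius [2 * (r0 / 3)] about the centers of a cover of its trace suffice. *)
have BC : ball x r `<=` \bigcup_(b in C) ball b.1 (2 * (r0 / 3)).
  move=> y /ballP xy; pose s := Order.min (r - mdist x y) (r0 / 3).
  have s0 : 0 < s by rewrite lt_min subr_gt0 xy divr_gt0.
  have sr : s <= r0 / 3 by rewrite ge_min lexx orbT.
  have sy : s <= r - mdist x y by rewrite ge_min lexx.
  have [|z [/ballP yz Lz]] := @ball_limsup_neq0 y s.
    by rewrite s0; have := r0_gt0; lra.
  have [|b Cb /ballP bz] := sC z.
    split=> //; apply/ballP; have := metric_triangle x y z; lra.
  exists b => //; apply/ballP; have /andP[_ br] := rC _ Cb.
  have := metric_triangle b.1 z y; rewrite (metric_sym z y); lra.
have null : hausdorff f (ball x r `\` La) = 0%E.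
  apply: (hausdorff_null_le g_ge0 f0 L0 d0 fg).
  apply/eqP; rewrite eq_le hausdorff_ge0// andbT.
  rewrite -(@hausdorff_null_bigcup _ _ g g_ge0 _ C
    (fun b => ball b.1 (2 * (r0 / 3)) `\` La) cC).
    by apply: le_hausdorff => // y [/BC[b Cb yb] nL]; exists b.
  by move=> b _; apply: ball_setD_limsup_null; have := r0_gt0; lra.
rewrite -{1}(setUIDK (ball x r) La).
by apply: le_trans (hausdorffU f0 _ _) _; rewrite null adde0.
Qed.

End fat.
End bounded_ratio.

(** * The case where f / g is unbounded near 0 *)

(* Contains every ball of C that meets [ball z s]; unlike the latter condition,
   it can be read off the centers and the radii. *)
Definition near_balls {R : realType} {X : metricType R} (C : set (X * R))
    (z : X) (s : R) : set (X * R) :=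
  C `&` [set b | mdist b.1 z < b.2 + s].

Section unbounded_ratio.
Context {R : realType} {X : metricType R}.
Variables (g : R -> R) (lam c1 c2 r0 : R).
Hypothesis gA : ahlfors X g lam c1 c2 r0.

Let gG := ahlfors_gauge gA.
Let g_ge0 := gauge_ge0 gG.
Let g_nd := gauge_nd gG.
Let lam_gt1 := gauge_lam_gt1 gG.
Let lam_gt0 := gauge_lam_gt0 gG.
Let c1_gt0 := ahlfors_c1_gt0 gA.
Let c2_gt0 := ahlfors_c2_gt0 gA.
Let r0_gt0 := ahlfors_r0_gt0 gA.
Let g_lb := ahlfors_lb gA.
Let g_ub := ahlfors_ub gA.
Let g_gt0 := doubling_gt0 gG.
Let g_half := doubling_half gG.
Let K := c2 * lam ^+ 3.
Let K_gt0 : 0 < K. Proof. by rewrite mulr_gt0// exprn_gt0. Qed.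

Variables (f : R -> R) (kappa : R).
Hypothesis kappa_bd : 0 <= kappa < 1.
Hypothesis f_gt0 : forall x, 0 < x -> 0 < f x.
Hypothesis f_nd : forall x y, 0 <= x -> x <= y -> f x <= f y.
Hypothesis fgk_nd : forall x y, 0 < x -> x <= y ->
  f x / g x `^ kappa <= f y / g y `^ kappa.
Hypothesis fg_ni : forall x y, 0 < x -> x <= y -> f y / g y <= f x / g x.

Lemma powR_split (x : R) : 0 < x -> x `^ (1 - kappa) * x `^ kappa = x.
Proof.
move=> x0; rewrite -powRD; last by rewrite (gt_eqF x0) implybT.
by rewrite subrK powRr1// ltW.
Qed.

Lemma powR_le_base (k x : R) : 1 <= k -> 0 <= x <= 1 -> k `^ x <= k.
Proof.
by move=> k1 /andP[x0 x1]; rewrite -[leRHS]powRr1 ?(le_trans ler01)// ler_powR.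
Qed.

(** As [f / g] is nonincreasing, [f] inherits the doubling constant of [g]. *)
Lemma f_half x : 0 < x -> f x / lam <= f (x / 2).
Proof.
move=> x0; have x20 : 0 < x / 2 by rewrite divr_gt0.
have := @fg_ni (x / 2) x x20; have -> : x / 2 <= x by lra.
move=> /(_ isT); rewrite ler_pdivlMr ?g_gt0// => /(le_trans _); apply.
rewrite mulrAC -mulrA ler_pM2l ?f_gt0// ler_pdivlMr ?g_gt0//.
by rewrite mulrC; exact: g_half.
Qed.

(** Turns the upper scaling bound into [f]-mass: monotonicity of [f / g ^ kappa] trades
    [g b ^ kappa] for [f b * g u ^ kappa / f u], and [4 = 2 ^ 2] costs [lam ^+ 2]. *)
Lemma lsp_upper_ratio (u b : R) : 0 < u -> u <= b ->
  g (u / 2) `^ (1 - kappa) * g (4 * b) `^ kappa <= lam ^+ 2 * (g u / f u) * f b.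
Proof.
move=> u0 ub; have b0 : 0 < b by exact: lt_le_trans ub.
have /andP[k0 k1] := kappa_bd.
have gu0 := g_gt0 u0; have gb0 := g_gt0 b0.
have h1 : g (u / 2) `^ (1 - kappa) <= g u `^ (1 - kappa).
  apply: ge0_ler_powR; rewrite ?nnegrE ?subr_ge0 ?(ltW k1)//.
  - by rewrite g_ge0// divr_ge0// ltW.
  - exact: ltW.
  - apply: g_nd; lra.
have h2 : g (4 * b) `^ kappa <= lam ^+ 2 * g b `^ kappa.
  apply: (@le_trans _ _ ((lam ^+ 2 * g b) `^ kappa)).
    apply: ge0_ler_powR; rewrite ?nnegrE//.
    - rewrite g_ge0// mulr_ge0//; lra.
    - by rewrite mulr_ge0 ?exprn_ge0// ltW.
    - apply: (doubling_le gG) => //; rewrite expr2; lra.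
  have lam2 : 1 <= lam ^+ 2 by rewrite exprn_ege1// ltW.
  rewrite (powRM _ (le_trans ler01 lam2) (ltW gb0)) ler_pM2r ?powR_gt0//.
  by apply: powR_le_base; rewrite ?k0 ?(ltW k1).
apply: (le_trans (ler_pM (powR_ge0 _ _) (powR_ge0 _ _) h1 h2)).
have := fgk_nd u0 ub.
have := powR_split gu0.
have := powR_ge0 (g u) (1 - kappa).
have : 0 < g u `^ kappa by exact: powR_gt0.
have : 0 < g b `^ kappa by exact: powR_gt0.
have := f_gt0 u0.
move: (g u `^ kappa) (g b `^ kappa) (g u `^ (1 - kappa)) =>
  p q s fu0 q0 p0 s0 <-.
rewrite ler_pdivrMr// mulrAC ler_pdivlMr// => H.
have -> : s * (lam ^+ 2 * q) = lam ^+ 2 * s * (q * f u) / f u by field;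
  rewrite gt_eqF.
have -> : lam ^+ 2 * (s * p / f u) * f b = lam ^+ 2 * s * (f b * p) / f u by
  ring.
rewrite ler_pM2r ?invr_gt0//.
by rewrite ler_wpM2l ?mulr_ge0 ?exprn_ge0 ?(ltW lam_gt0)// mulrC.
Qed.

(** Counterpart for the lower scaling bound: the hypothesis on [r] replaces a factor
    [g r ^ (1 - kappa)] by [M * f u / g u ^ kappa], and [lam] pays for halving [u]. *)
Lemma lsp_lower_ratio (u r M : R) : 0 < u -> 0 < r -> 0 < M ->
  g r `^ (1 - kappa) <= M * (f u / g u `^ kappa) ->
  g r / (lam * M) * (g u / f u) <= g (u / 2) `^ (1 - kappa) * g r `^ kappa.
Proof.
move=> u0 r_gt0 M0 rM; have /andP[k0 k1] := kappa_bd.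
have gu0 := g_gt0 u0; have gr0 := g_gt0 r_gt0.
have u20 : 0 < u / 2 by rewrite divr_gt0.
have h : g u `^ (1 - kappa) <= lam * g (u / 2) `^ (1 - kappa).
  apply: (@le_trans _ _ ((lam * g (u / 2)) `^ (1 - kappa))).
    apply: ge0_ler_powR; rewrite ?nnegrE ?subr_ge0 ?(ltW k1) ?(ltW gu0)//.
    - by rewrite mulr_ge0 ?(ltW lam_gt0) ?g_ge0 ?(ltW u20).
    - by have := g_half u0; rewrite ler_pdivrMr// mulrC.
  rewrite (powRM _ (ltW lam_gt0) (g_ge0 (ltW u20))) ler_wpM2r ?powR_ge0//.
  apply: powR_le_base; first exact: ltW.
  by apply/andP; split; lra.
move: h rM (powR_split gu0) (powR_split gr0) (powR_gt0 kappa gu0)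
  (powR_gt0 kappa gr0) (powR_ge0 (g (u / 2)) (1 - kappa)) (f_gt0 u0)
  (powR_ge0 (g u) (1 - kappa)).
move: (g u `^ kappa) (g r `^ kappa) (g u `^ (1 - kappa)) (g r `^ (1 - kappa)).
move=> p B s t; move: (g (u / 2) `^ (1 - kappa)) => A.
move=> sA tM <- <- p0 B0 A0 fu0 s0.
apply: (@le_trans _ _ (B * (s / lam))); last first.
  by rewrite mulrC ler_pM2r// ler_pdivrMr// mulrC.
have -> : t * B / (lam * M) * (s * p / f u) = (B * (s / lam)) * (t * p / (M * f
  u)).
  by field; rewrite !gt_eqF.
rewrite ler_piMr//; first by rewrite mulr_ge0 ?divr_ge0 ?(ltW B0) ?(ltW
  lam_gt0).
rewrite ler_pdivrMr ?mulr_gt0// mul1r; move: tM; rewrite mulrA.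
by rewrite ler_pdivlMr.
Qed.

(* With this constant, the fivefold enlargements of the balls of C close to a
   sparse ball cover at most half of its concentric ball of half the radius. *)
Let c0 := c1 / (2 * c2 * lam ^+ 4).

Definition sparse (C : set (X * R)) (z : X) (s : R) : Prop :=
  (\esum_(b in near_balls C z s) (g b.2)%:E <= (c0 * g s)%:E)%E.

Section lsp.
Variables (F : nat -> set X) (U : nat -> R) (c3 c4 r1 : R).
Hypothesis c3_gt0 : 0 < c3.
Hypothesis c4_gt0 : 0 < c4.
Hypothesis r1_gt0 : 0 < r1.
Hypothesis F_lsp : forall (r delta : R) (j : nat) (x : X),
  0 < r < r1 -> 0 <= delta < r -> F j x ->
  ((c3 * (g delta `^ (1 - kappa) * g r `^ kappa))%:E
     <= hausdorff g (ball x r `&` nbhood (F j) delta)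
     <= (c4 * (g delta `^ (1 - kappa) * g r `^ kappa))%:E)%E.

Variables (Lg : set X) (M : R).
Hypothesis M_gt0 : 0 < M.
Hypothesis Lg_full : forall (x : X) r, 0 < r ->
  hausdorff g (ball x r `&` Lg) = hausdorff g (ball x r).
Hypothesis Lg_hit : forall (x : X) (n : nat) (delta : R), Lg x -> 0 < delta ->
  exists j y T, [/\ (n <= j)%N, F j y, mdist x y < T < delta, 0 < U j <= T &
    g T `^ (1 - kappa) <= M * (f (U j) / g (U j) `^ kappa)].
Hypothesis c1_le_c2 : c1 <= c2.
Let c0_gt0 : 0 < c0.
Proof. by rewrite divr_gt0// !mulr_gt0// exprn_gt0. Qed.

Let G := tail_nbhood F U.

Let c0_lt1 : c0 < 1.
Proof.
rewrite ltr_pdivrMr ?mul1r; last by rewrite !mulr_gt0 ?exprn_gt0.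
apply: (le_lt_trans c1_le_c2); rewrite -mulrA mulrCA ltr_pMr//.
have : 1 <= lam ^+ 4 by rewrite exprn_ege1// ltW.
lra.
Qed.

(** * From a sparse ball to a smaller one *)

Section step.
Variables (C : set (X * R)).
Hypothesis C_countable : countable C.
Hypothesis C_gt0 : forall b, C b -> 0 < b.2.

Let f_ge0 (b : X * R) : C b -> (0 <= (f b.2)%:E)%E.
Proof. by move=> /C_gt0 b0; rewrite lee_fin ltW// f_gt0. Qed.

Let Cy (y : X) (r : R) := C `&` [set b | b.2 < r /\ mdist b.1 y < 4 * r].

(** The two terms are the constants for the sets [S1] and [S2] in the next proof. *)
Let K3 (c : R) := c4 * lam ^+ 2 + K * lam / c.

(** Points within [u / 2] of some [z] in [F j] are split by whether a ball of [C] near [z] has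
    radius at least [u]. If so, local scaling bounds the part near that ball; otherwise disjoint
    balls about such [z] receive disjoint shares of the [f]-sum. *)
Lemma local_mass_ub (j : nat) (y : X) (r u c : R) :
  0 < c -> F j y -> 0 < u -> u <= r -> 10 * r < r0 -> 4 * r < r1 ->
  (forall z, F j z -> mdist z y < 2 * r ->
     near_balls C z (u / 2) `<=` Cy y r /\
     ((c * f u)%:E <= \esum_(b in near_balls C z (u / 2)) (f b.2)%:E)%E) ->
  (hausdorff g (ball y r `&` nbhood (F j) (u / 2)) <=
    (K3 c * (g u / f u))%:E * \esum_(b in Cy y r) (f b.2)%:E)%E.
Proof.
move=> cpos Fy u0 ur rr0 rr1 near_mass.
have fu0 := f_gt0 u0; have gu0 := g_gt0 u0.
set S := _ `&` _; set m := esum _ _.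
pose CB := Cy y r `&` [set b | u <= b.2 /\ exists2 z,
  F j z & mdist b.1 z < 2 * b.2].
pose S1 := \bigcup_(b in CB) (ball b.1 (2 * b.2) `&` nbhood (F j) (u / 2)).
pose light z := forall b, near_balls C z (u / 2) b -> b.2 < u.
pose S2 := [set w | exists z, [/\ F j z, mdist z y < 2 * r,
  mdist w z < u / 2 & light z]].
have SS : S `<=` S1 `|` S2.
  move=> w [/ballP yw Fw]; have [z Fz wz] := (nbhoodP _ _ _).1 Fw.
  have zy : mdist z y < 2 * r.
    have := metric_triangle z w y; rewrite (metric_sym z w) (metric_sym w y);
      lra.
  have [lz|] := pselect (light z); first by right; exists z.
  move=> /existsNP[b /not_implyP[Nb /negP]]; rewrite -leNgt => ub; left.
  have [NC _] := near_mass z Fz zy.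
  have [_ /= bz] := Nb.
  exists b; first by split; [exact: NC|split=> //; exists z => //; lra].
  split=> //; apply/ballP; have := metric_triangle b.1 z w.
  rewrite (metric_sym z w); lra.
have m0 : (0 <= m)%E by apply: esum_ge0 => b [/f_ge0].
have muS1 : (hausdorff g S1 <= (c4 * lam ^+ 2 * (g u / f u))%:E * m)%E.
  have cCB : countable CB.
    by apply: sub_countable C_countable; apply: subset_card_le => b [[]].
  apply: le_trans (hausdorff_bigcup g_ge0 _ cCB) _.
  apply: (@le_trans _ _ (\esum_(b in CB) ((c4 * lam ^+ 2 * (g u / f u))%:E * (f
    b.2)%:E))%E).
    apply: le_esum => b [[Cb [br by_]] [ub [z Fz bz]]].
    have b0 := C_gt0 Cb.
    apply: (@le_trans _ _ (hausdorff g (ball z (4 * b.2) `&` nbhood (F j) (u /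
      2)))).
      apply: le_hausdorff => // w [bw Fw]; split=> //.
      apply: ball_subset bw; rewrite metric_sym; lra.
    have [||_] := andP (@F_lsp (4 * b.2) (u / 2) j z _ _ Fz).
    - by apply/andP; split; lra.
    - by apply/andP; split; lra.
    move/le_trans; apply; rewrite -EFinM lee_fin.
    have -> : c4 * lam ^+ 2 * (g u / f u) * f b.2 =
      c4 * (lam ^+ 2 * (g u / f u) * f b.2) by rewrite !mulrA.
    by rewrite ler_pM2l//; exact: lsp_upper_ratio.
  apply: le_trans (esumZl_le _ _) _.
  - by rewrite mulr_ge0 ?divr_ge0 ?(ltW gu0) ?(ltW fu0)// mulr_ge0 ?exprn_ge0
    ?(ltW c4_gt0) ?(ltW lam_gt0).
  - by move=> b [[/f_ge0]].
  rewrite lee_wpmul2l//; last by apply: subset_esum => b [].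
  by rewrite lee_fin mulr_ge0 ?divr_ge0 ?(ltW gu0) ?(ltW fu0)// mulr_ge0
    ?exprn_ge0 ?(ltW c4_gt0) ?(ltW lam_gt0).
have muS2 : (hausdorff g S2 <= (K * lam / c * (g u / f u))%:E * m)%E.
  pose V := [set p : X * R | [/\ F j p.1, mdist p.1 y < 2 * r,
    light p.1 & p.2 = 2 * u]].
  have [||||D [DV cD tD AD]] := @vitali_hausdorff _ _ _ _ _ _ _ gA S2 V (2 * u).
  - lra.
  - apply: (@le_lt_trans _ _ (hausdorff g (ball y (3 * r)))).
      apply: le_hausdorff => // w [z [Fz zy wz _]]; apply/ballP.
      have := metric_triangle y z w;
        rewrite (metric_sym y z) (metric_sym z w); lra.
    by apply: (hausdorff_ball_fin gA); lra.
  - by move=> p [_ _ _ ->]; apply/andP; split; lra.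
  - move=> w [z [Fz zy wz lz]]; exists (z, 2 * u) => //; apply/ballP => /=.
    by rewrite metric_sym; lra.
  apply: (le_trans AD).
  have k0 : 0 <= K * lam / c * (g u / f u).
    by rewrite mulr_ge0 ?divr_ge0 ?(ltW gu0) ?(ltW fu0) ?(ltW cpos)// mulr_ge0
      ?(ltW K_gt0) ?(ltW lam_gt0).
  apply: (@le_trans _ _ (\esum_(p in D) ((K * lam / c * (g u / f u))%:E *
      \esum_(b in near_balls C p.1 (u / 2)) (f b.2)%:E))%E).
    apply: le_esum => p /DV[Fp py _ ->].
    have [_ mp] := near_mass _ Fp py.
    apply: le_trans (lee_wpmul2l _ mp); last by rewrite lee_fin.
    rewrite -EFinM lee_fin -/K.
    have -> : K * lam / c * (g u / f u) * (c * f u) = K * (lam * g u).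
      by field; rewrite !gt_eqF.
    by rewrite ler_pM2l// ltW// (gauge_dbl gG).
  apply: le_trans (esumZl_le k0 _) _.
    by move=> p _; apply: esum_ge0 => b [/f_ge0].
  rewrite lee_wpmul2l ?lee_fin//.
  apply: esum_disjoint_le.
  - by move=> p b /DV[Fp py _ _] Nb; have [NC _] := near_mass _ Fp py;
    exact: NC.
  - by move=> b [/f_ge0].
  (* As [b.2 < u], the center of [b] is within [3 * u / 2] of both centers, hence in both disjoint
     balls of radius [2 * u]. *)
  move=> p q b Dp Dq [Cb pb] [_ qb]; apply: tD => //; exists b.1.
  have [Fp py lp pu] := DV _ Dp; have [Fq qy lq qu] := DV _ Dq.
  have bu : b.2 < u by exact: (lp b).
  rewrite pu qu; split; apply/ballP; rewrite metric_sym.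
    by move: pb => /=; lra.
  by move: qb => /=; lra.
apply: (@le_trans _ _ (hausdorff g (S1 `|` S2))); first exact: le_hausdorff.
apply: le_trans (hausdorffU g_ge0 _ _) _.
apply: (le_trans (leeD muS1 muS2)).
have gf0 : 0 <= g u / f u by rewrite divr_ge0 ?(ltW gu0) ?(ltW fu0).
rewrite -ge0_muleDl ?lee_fin.
- by rewrite -EFinD /K3 mulrDl.
- by rewrite mulr_ge0// mulr_ge0 ?exprn_ge0 ?(ltW c4_gt0) ?(ltW lam_gt0).
- by rewrite mulr_ge0// divr_ge0 ?(ltW cpos)// mulr_ge0 ?(ltW K_gt0) ?(ltW
  lam_gt0).
Qed.

(** Lower local scaling is set against [local_mass_ub]; the common factor [g u / f u] cancels. *)
Lemma local_mass (j : nat) (y : X) (r u c : R) :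
  0 < c -> F j y -> 0 < u -> u <= r -> 10 * r < r0 -> 4 * r < r1 ->
  g r `^ (1 - kappa) <= M * (f u / g u `^ kappa) ->
  (forall z, F j z -> mdist z y < 2 * r ->
     near_balls C z (u / 2) `<=` Cy y r /\
     ((c * f u)%:E <= \esum_(b in near_balls C z (u / 2)) (f b.2)%:E)%E) ->
  ((c3 / (K3 c * (lam * M)) * g r)%:E <= \esum_(b in Cy y r) (f b.2)%:E)%E.
Proof.
move=> cpos Fy u0 ur rr0 rr1 rM near_mass.
have := local_mass_ub cpos Fy u0 ur rr0 rr1 near_mass.
set m := esum _ _; have m0 : (0 <= m)%E by apply: esum_ge0 => b [/f_ge0].
have [->|moo] := eqVneq m +oo%E; first by move=> _; exact: leey.
have -> : m = (fine m)%:E by rewrite fineK// ge0_fin_numE// ltey.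
move: (fine m) => {m m0 moo} m.
have r_gt0 : 0 < r by exact: lt_le_trans ur.
have [||lb _] := andP (@F_lsp r (u / 2) j y _ _ Fy).
- by rewrite r_gt0/=; lra.
- by apply/andP; split; lra.
move=> /(le_trans lb); rewrite -EFinM !lee_fin => H.
have {}H := le_trans (ler_wpM2l (ltW c3_gt0) (lsp_lower_ratio u0 r_gt0 M_gt0
  rM)) H.
have fu0 := f_gt0 u0; have gu0 := g_gt0 u0.
have K30 : 0 < K3 c.
  by rewrite addr_gt0 ?divr_gt0 ?mulr_gt0 ?exprn_gt0.
have gf0 : 0 < g u / f u by rewrite divr_gt0.
move: (g u / f u) gf0 H => t t0 H.
rewrite -(ler_pM2r t0) -(ler_pM2l K30).
have -> : K3 c * (c3 / (K3 c * (lam * M)) * g r * t) = c3 * (g r / (lam * M) *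
  t).
  by field; rewrite !gt_eqF.
by apply: (le_trans H); rewrite -mulrA (mulrC t).
Qed.

(** One near ball of radius at least [s] already contributes [f s]. Otherwise all radii are below
    [s], and [f / g] being nonincreasing turns the large [g]-sum into a large [f]-sum. *)
Lemma not_sparse_mass z s : c0 <= 1 -> 0 < s -> ~ sparse C z s ->
  ((c0 * f s)%:E <= \esum_(b in near_balls C z s) (f b.2)%:E)%E.
Proof.
move=> c01 s0 /negP; rewrite -ltNge => Hg.
have fs0 := f_gt0 s0; have gs0 := g_gt0 s0.
have [[b [Nb sb]]|nbig] := pselect (exists b, near_balls C z s b /\ s <= b.2).
  apply: (@le_trans _ _ (f b.2)%:E).
    rewrite lee_fin; apply: (@le_trans _ _ (f s));
      first by rewrite ler_piMl// ltW.
    by apply: f_nd => //; exact: ltW.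
  by apply: (@esum_ge_elt _ _ _ (fun b : X * R => (f b.2)%:E)) => //;
    apply: f_ge0; case: Nb.
set m := esum _ _; have m0 : (0 <= m)%E by apply: esum_ge0 => b [/f_ge0].
have : (\esum_(b in near_balls C z s) (g b.2)%:E <= (g s / f s)%:E * m)%E.
  have gf0 : 0 <= g s / f s by rewrite divr_ge0 ?(ltW gs0) ?(ltW fs0).
  apply: le_trans (esumZl_le gf0 _); last by move=> b [/f_ge0].
  apply: le_esum => b Nb; rewrite -EFinM lee_fin.
  have b0 : 0 < b.2 by apply: C_gt0; case: Nb.
  have bs : b.2 <= s by rewrite leNgt; apply/negP => /ltW sb; apply: nbig;
    exists b.
  have := fg_ni b0 bs; rewrite ler_pdivlMr ?g_gt0// => H.
  rewrite mulrAC ler_pdivlMr//.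
  have -> : g b.2 * f s = g s * (f s / g s * g b.2) by field; rewrite gt_eqF.
  by rewrite ler_pM2l.
have [->|moo] := eqVneq m +oo%E; first by move=> _; exact: leey.
have -> : m = (fine m)%:E by rewrite fineK// ge0_fin_numE// ltey.
move: (fine m) => {m m0 moo} m /(lt_le_trans Hg).
rewrite -EFinM lte_fin lee_fin => /ltW H.
rewrite -(ler_pM2l gs0).
have -> : g s * (c0 * f s) = f s * (c0 * g s) by ring.
have -> : g s * m = f s * (g s / f s * m) by field; rewrite gt_eqF.
by rewrite ler_pM2l.
Qed.

Hypothesis C_sum : (\esum_(b in C) (f b.2)%:E < +oo)%E.

Lemma sparse_step (x0 : X) (r : R) (n : nat) (delta : R) :
  0 < r -> 5 * r < r0 -> 0 < delta -> sparse C x0 r ->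
  exists z s, [/\ 0 < s < delta, mdist z x0 + s <= r,
    [set w | mdist z w <= s] `<=` G n & sparse C z s].
Proof.
move=> r_gt0 rr0 delta0 spB; apply: contrapT => nstep.
have gr0 := g_gt0 r_gt0.
pose N := near_balls C x0 r.
(* Since [c0 < 1], a single ball of radius at least [r] would violate sparsity. *)
have Nr b : N b -> b.2 < r.
  move=> Nb; rewrite ltNge; apply/negP => rb.
  have b0 : 0 < b.2 by apply: C_gt0; case: Nb.
  have : ((g b.2)%:E <= (c0 * g r)%:E)%E.
    apply: le_trans spB; apply: (@esum_ge_elt _ _ _ (fun b : X * R =>
      (g b.2)%:E)) => //.
    by rewrite lee_fin g_ge0// ltW.
  rewrite lee_fin leNgt => /negP; apply.
  have := g_nd (ltW r_gt0) rb; apply: lt_le_trans.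
  by rewrite gtr_pMl.
(* By sparsity the removed enlargements have mass at most [a], half of the lower bound for
   [ball x0 (r / 2)]. *)
pose A := (ball x0 (r / 2) `&` Lg) `\` \bigcup_(b in N) ball b.1 (5 * b.2).
pose a := c1 / (2 * lam) * g r.
have a0 : 0 < a by rewrite mulr_gt0 ?divr_gt0 ?mulr_gt0.
have aA : (a%:E <= hausdorff g A)%E.
  have cN : countable N.
    by apply: sub_countable C_countable; apply: subset_card_le => b [].
  have : (hausdorff g (ball x0 (r / 2)) <= hausdorff g A + (K * (c0 * g
    r))%:E)%E.
    rewrite -Lg_full ?divr_gt0//.
    apply: (@le_trans _ _ (hausdorff g (A `|` \bigcup_(b in N) ball b.1 (5 *
      b.2)))).
      apply: le_hausdorff => // x Bx.
      have [Nx|nNx] := pselect ((\bigcup_(b in N) ball b.1 (5 * b.2)) x);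
        first by right.
      by left; split.
    apply: le_trans (hausdorffU g_ge0 _ _) _; rewrite leeD2l//.
    apply: le_trans (hausdorff_bigcup g_ge0 _ cN) _.
    apply: (@le_trans _ _ (K%:E * \esum_(b in N) (g b.2)%:E)%E); last first.
      by rewrite (EFinM K) lee_wpmul2l ?lee_fin// ltW.
    apply: le_trans (esumZl_le (ltW K_gt0) _); last first.
      by move=> b [/C_gt0 b0 _]; rewrite lee_fin g_ge0// ltW.
    apply: le_esum => b Nb; have br := Nr b Nb.
    have b0 : 0 < b.2 by apply: C_gt0; case: Nb.
    apply: le_trans (g_ub _ _) _; first by apply/andP; split; lra.
    rewrite -EFinM lee_fin /K -mulrA ler_pM2l//; apply: (doubling_le gG) => //.
    by rewrite (_ : 2 ^+ 3 = 8 :> R)//; [lra|rewrite !exprS expr0; lra].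
  have : ((c1 * g (r / 2))%:E <= hausdorff g (ball x0 (r / 2)))%E.
    by apply: g_lb; apply/andP; split; lra.
  move=> /le_trans h /h; rewrite -leeBlDr// -EFinB; apply: le_trans.
  rewrite lee_fin.
  have -> : K * (c0 * g r) = a.
    by rewrite /K /c0 /a; field; rewrite !gt_eqF.
  have := g_half r_gt0; rewrite -(ler_pM2l c1_gt0).
  have -> : c1 * (g r / lam) = a + a by rewrite /a; field; rewrite gt_eqF.
  lra.
(* The constant of [local_mass] for [c = c0 / lam]; the factor [lam ^+ 2] pays for enlarging [T] to
   [4 * T]. *)
pose c5 := c3 / (K3 (c0 / lam) * (lam * M)) / lam ^+ 2.
have c50 : 0 < c5.
  by rewrite !divr_gt0 ?mulr_gt0 ?exprn_gt0// addr_gt0 ?divr_gt0 ?mulr_gt0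
    ?exprn_gt0.
have [d d0 dP] := esum_tail C_gt0 f_ge0 C_sum (divr_gt0 (mulr_gt0 a0 c50)
  K_gt0).
(* With [T < m], the new balls stay inside the sparse one, local scaling applies at radius [4 * T],
   only balls of [C] of radius below [d] are counted, and the new radius is below [delta]. *)
pose m := Order.min (Order.min (r / 8) (r1 / 4)) (Order.min (d / 4) delta).
have m0 : 0 < m by rewrite !lt_min !divr_gt0.
have [mr mr1 md mdelta] : [/\ m <= r / 8, m <= r1 / 4, m <= d / 4 & m <= delta].
  by split; rewrite !ge_min lexx ?orbT.
pose V := [set p : X * R | 0 < p.2 <= 4 * m /\
  ((c5 * g p.2)%:E <=
     \esum_(b in C `&` [set b | (b.2 < p.2 /\ mdist b.1 p.1 < p.2)%R]) (f
       b.2)%:E)%E].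
have [||||D [DV cD tD AD]] := @vitali_hausdorff _ _ _ _ _ _ _ gA A V (4 * m).
- lra.
- apply: (@le_lt_trans _ _ (hausdorff g (ball x0 (r / 2)))).
    by apply: le_hausdorff => // w [[]].
  by apply: (hausdorff_ball_fin gA); lra.
- by move=> p [].
- move=> x [[/ballP x0x Lx] Nx].
  have [j [y [T [nj Fy /andP[xy Tm] /andP[U0 UT] gT]]]] := Lg_hit n Lx m0.
  have T0 : 0 < T by exact: lt_le_trans UT.
  exists (y, 4 * T); last first.
    by apply/ballP => /=; rewrite metric_sym; lra.
  split => /=; first by apply/andP; split; lra.
  apply: (@le_trans _ _ (c3 / (K3 (c0 / lam) * (lam * M)) * g T)%:E).
    rewrite lee_fin /c5 -[leLHS]mulrA ler_pM2l; last first.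
      by rewrite !divr_gt0 ?mulr_gt0// addr_gt0 ?divr_gt0 ?mulr_gt0 ?exprn_gt0.
    rewrite ler_pdivrMl ?exprn_gt0//; apply: (doubling_le gG) => //.
    by rewrite expr2; lra.
  apply: (@le_trans _ _ (\esum_(b in Cy y T) (f b.2)%:E)%E); last first.
    by apply: subset_esum => b [Cb /= [bT bD]]; split=> //=; split=> //; lra.
  apply: (@local_mass j y T (U j) (c0 / lam)) => //.
  + by rewrite divr_gt0.
  + lra.
  + lra.
  move=> z Fz zy.
  have zx0 : mdist z x0 + U j / 2 <= r.
    have := metric_triangle z y x0; have := metric_triangle y x x0.
    rewrite (metric_sym y x) (metric_sym x x0); lra.
  split.
    move=> b [Cb /= bz]; split=> //=.
    have Nb : N b.
      by split=> //=; have := metric_triangle b.1 z x0; lra.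
    (* Outside the fivefold enlargement, [5 * b.2 <= mdist b.1 x < b.2 + 7 * T / 2], which forces
       [b.2 < T]. *)
    have : ~ mdist b.1 x < 5 * b.2.
      by move=> bx; apply: Nx; exists b => //; apply/ballP.
    move/negP; rewrite -leNgt => bx.
    have := metric_triangle b.1 z x; have := metric_triangle z y x.
    have := metric_triangle b.1 z y.
    rewrite (metric_sym y x); split; lra.
  have U20 : 0 < U j / 2 by rewrite divr_gt0.
  apply: (@le_trans _ _ (c0 * f (U j / 2))%:E).
    by rewrite lee_fin mulrAC -mulrA ler_pM2l// f_half.
  apply: not_sparse_mass => //; first exact: ltW.
  (* Such a sparse ball is what [nstep] denies; halving [U j] puts its closed ball inside the open
     neighbourhood. *)
  move=> sp; apply: nstep; exists z, (U j / 2); split=> //.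
  - by apply/andP; split; lra.
  - move=> w /= zw; exists j => //; apply/nbhoodP; exists z => //.
    by rewrite metric_sym; lra.
(* Disjoint Vitali balls count disjoint subfamilies of [C], so the tail of the [f]-sum bounds [a],
   against the choice of [d]. *)
have : (a%:E <= (K / c5)%:E * \esum_(b in C `&` [set b | (b.2 < d)%R]) (f
  b.2)%:E)%E.
  apply: (le_trans aA); apply: (le_trans AD).
  have kc0 : 0 <= K / c5 by rewrite divr_ge0 ?(ltW K_gt0) ?(ltW c50).
  apply: (@le_trans _ _ (\esum_(p in D) ((K / c5)%:E *
    \esum_(b in C `&` [set b | (b.2 < p.2 /\ mdist b.1 p.1 < p.2)%R]) (f
      b.2)%:E))%E).
    apply: le_esum => p /DV[_ pm].
    apply: le_trans (lee_wpmul2l _ pm); last by rewrite lee_fin.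
    by rewrite -EFinM lee_fin -/K mulrA divfK ?gt_eqF.
  apply: le_trans (esumZl_le kc0 _) _.
    by move=> p _; apply: esum_ge0 => b [/f_ge0].
  rewrite lee_wpmul2l ?lee_fin//.
  apply: esum_disjoint_le.
  - move=> p b /DV[/andP[_ pm] _] [Cb [/= bp _]]; split=> //=; lra.
  - by move=> b [/f_ge0].
  move=> p q b Dp Dq [Cb [_ pb]] [_ [_ qb]]; apply: tD => //; exists b.1.
  by split; apply/ballP; rewrite metric_sym.
rewrite leNgt => /negP; apply.
have KC0 : 0 < K / c5 by rewrite divr_gt0.
have := dP; set t := esum _ _; move=> tlt.
have t0 : (0 <= t)%E by apply: esum_ge0 => b [/f_ge0].
have tE : t = (fine t)%:E.
  by rewrite fineK// ge0_fin_numE//; apply: lt_trans tlt _; rewrite ltry.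
rewrite tE -EFinM lte_fin; move: tlt; rewrite tE lte_fin => tlt.
rewrite -(ltr_pM2l KC0) in tlt; apply: (lt_le_trans tlt).
by rewrite le_eqVlt; apply/orP; left; apply/eqP; field; rewrite !gt_eqF.
Qed.

End step.

(** * Nested sparse balls and infinite measure *)

Let La := limsup_nbhood F U.

(** Iterating [sparse_step] gives nested balls whose centers cluster at some [p] of the compact [T];
    being closed, the balls retain [p]. A ball of [C] containing [p] would be too heavy for a sparse
    ball smaller than it. *)
Lemma sparse_point (C : set (X * R)) (x0 : X) (s0 : R) (T : set X) :
  countable C -> (forall b, C b -> 0 < b.2) ->
  (\esum_(b in C) (f b.2)%:E < +oo)%E ->
  0 < s0 -> 5 * s0 < r0 -> sparse C x0 s0 ->
  compact T -> [set w | mdist x0 w <= s0] `<=` T ->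
  exists p, [/\ mdist x0 p <= s0, La p & forall b, C b -> ~ ball b.1 b.2 p].
Proof.
move=> cC C0 Cf s00 sr0 sp0 cT BT.
pose good (q : X * R) := [/\ 0 < q.2, 5 * q.2 < r0 & sparse C q.1 q.2].
have /choice[h hP] (nq : nat * (X * R)) : exists q, good nq.2 ->
    [/\ good q, q.2 < nq.1.+1%:R^-1, mdist q.1 nq.2.1 + q.2 <= nq.2.2 &
      [set w | mdist q.1 w <= q.2] `<=` G nq.1].
  case: nq => n q /=.
  (* A default value is used when [q] is not good; the iteration only meets good pairs. *)
  have [[q0 qr qs]|] := pselect (good q); last by exists q.
  have n0 : 0 < n.+1%:R^-1 :> R by rewrite invr_gt0.
  have [z [s [/andP[s_gt0 sn] zs zG zsp]]] :=
    sparse_step cC C0 Cf n q0 qr n0 qs.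
  exists (z, s) => _; split=> //; split=> //=.
  have := mdist_ge0 z q.1; lra.
(* Step [n] produces [q n.+1], whose closed ball lies in [G n]. *)
pose q := fix q n := if n is n'.+1 then h (n', q n') else (x0, s0).
have gq n : good (q n) by elim: n => [|n IHn]; [split|case: (hP (n, q n) IHn)].
have qS n : mdist (q n.+1).1 (q n).1 + (q n.+1).2 <= (q n).2.
  by case: (hP (n, q n) (gq n)).
have qle n m : (n <= m)%N -> mdist (q m).1 (q n).1 + (q m).2 <= (q n).2.
  elim: m => [|m IHm]; first by rewrite leqn0 => /eqP->; rewrite mdistxx add0r.
  rewrite leq_eqVlt => /orP[/eqP->|]; first by rewrite mdistxx add0r.
  rewrite ltnS => /IHm nm; have := metric_triangle (q m.+1).1 (q m).1 (q n).1.
  have := qS m; lra.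
have qT : ((fun n => (q n).1) @ \oo) T.
  exists 0%N => // m _; apply: BT => /=; rewrite metric_sym.
  have [qm0 _ _] := gq m; have /= := qle 0%N m isT; lra.
have [p [Tp clp]] := cT _ _ qT.
have pq n : mdist (q n).1 p <= (q n).2.
  rewrite leNgt; apply/negP => np.
  have e0 : 0 < mdist (q n).1 p - (q n).2 by rewrite subr_gt0.
  have [||w [/= qw /ballP pw]] := clp [set w | mdist (q n).1 w <= (q n).2]
    (ball p (mdist (q n).1 p - (q n).2)).
  - exists n => // m /= nm; rewrite metric_sym.
    have [qm0 _ _] := gq m; have := qle _ _ nm; lra.
  - exact: nbhsx_ballx.
  have := metric_triangle (q n).1 w p; rewrite (metric_sym w p); lra.
exists p; split; first exact: (pq 0%N).
- rewrite /La limsup_nbhoodE => n _.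
  have [_ _ _ Gn] := hP (n, q n) (gq n).
  by apply: Gn => /=; exact: (pq n.+1).
move=> b Cb /ballP bp; have b0 := C0 _ Cb.
have [n _ /(_ n (leqnn n)) nb] := near_infty_natSinv_lt (PosNum b0).
have [_ qn _ _] := hP (n, q n) (gq n).
have [q0 _ qsp] := gq n.+1.
have : ((g b.2)%:E <= (c0 * g (q n.+1).2)%:E)%E.
  apply: le_trans qsp; apply: (@esum_ge_elt _ _ _ (fun b : X * R =>
    (g b.2)%:E)).
    split=> //=; have := metric_triangle b.1 p (q n.+1).1.
    have := pq n.+1; rewrite (metric_sym p); move: bp; rewrite /=; lra.
  by rewrite lee_fin g_ge0// ltW.
rewrite lee_fin leNgt => /negP; apply.
apply: (@le_lt_trans _ _ (c0 * g b.2)); last by rewrite gtr_pMl ?g_gt0.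
rewrite ler_pM2l//; apply: g_nd; first exact: ltW.
by apply: ltW; exact: lt_trans qn nb.
Qed.

(** A finite value would give a cover of finite [f]-sum by balls so small that their [g]-sum makes
    the ball [(x, s0)] sparse; [sparse_point] then finds an uncovered point. *)
Lemma hausdorff_limsup_unbounded_ratio :
  locally_compact [set: X] -> 0 <= f 0 ->
  (forall k, exists2 d, 0 < d & forall u, 0 < u < d -> k <= f u / g u) ->
  forall (x : X) r, 0 < r -> hausdorff f (ball x r `&` La) = +oo%E.
Proof.
move=> lcX f00 fgoo x r r_gt0; apply/eqP; rewrite -leye_eq leNgt;
  apply/negP => Boo.
have f_ge0 t : 0 <= t -> 0 <= f t.
  by move=> t0; apply: (le_trans f00); exact: f_nd.
have [k k0 Bk] : exists2 k :
  R, 0 < k & (hausdorff f (ball x r `&` La) < k%:E)%E.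
  have := hausdorff_ge0 f_ge0 (ball x r `&` La).
  case: (hausdorff f (ball x r `&` La)) Boo => [h _|//|//];
    rewrite lee_fin => h0.
  by exists (h + 1); [lra|rewrite lte_fin; lra].
have [T Tx [cT _]] := lcX x I.
have {}Tx : nbhs x T by move: Tx; rewrite withinET.
have [e /= e0 eT] := (nbhs_ballP _ _).1 Tx.
pose s0 := Order.min (r / 2) (Order.min (e / 2) (r0 / 10)).
have s00 : 0 < s0 by rewrite !lt_min !divr_gt0.
have [sr se sr0] : [/\ s0 <= r / 2, s0 <= e / 2 & s0 <= r0 / 10].
  by split; rewrite !ge_min lexx ?orbT.
have gs0 := g_gt0 s00.
(* Below [d], [g] is at most [c0 * g s0 / k] times [f], so an [f]-sum below [k] has [g]-sum at most
   [c0 * g s0]. *)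
have [d d0 dP] := fgoo (k / (c0 * g s0)).
have [C [cC Cd Ccov] Ck] := hausdorff_content_cover d0 Bk.
have C0 b : C b -> 0 < b.2 by move=> /Cd/andP[].
have [||||p [xp Lp pC]] := @sparse_point C x s0 T cC C0 _ s00 _ _ cT.
- by apply: lt_trans Ck _; rewrite ltry.
- lra.
- apply: (@le_trans _ _ (\esum_(b in C) ((c0 * g s0 / k)%:E * (f b.2)%:E))%E).
    apply: (@le_trans _ _ (\esum_(b in C) (g b.2)%:E)%E).
      by apply: subset_esum => b [].
    apply: le_esum => b Cb; have b0 := C0 _ Cb.
    have := dP _ (Cd _ Cb); rewrite ler_pdivlMr ?g_gt0// => H.
    rewrite -EFinM lee_fin mulrAC ler_pdivlMr//.
    have -> : g b.2 * k = c0 * g s0 * (k / (c0 * g s0) * g b.2).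
      by field; rewrite !gt_eqF.
    by rewrite ler_pM2l// mulr_gt0.
  have kk : 0 <= c0 * g s0 / k.
    by apply: divr_ge0; [apply: mulr_ge0; exact: ltW|exact: ltW].
  apply: le_trans (esumZl_le kk _) _.
    by move=> b Cb; rewrite lee_fin f_ge0// ltW// C0.
  apply: (@le_trans _ _ ((c0 * g s0 / k)%:E * k%:E)%E).
    by rewrite lee_wpmul2l ?lee_fin// ltW.
  by rewrite -EFinM divfK// gt_eqF.
- by move=> w /= xw; apply: eT; apply/ballP; lra.
have [|b Cb bp] := Ccov p.
  by split=> //; apply/ballP; lra.
exact: pC Cb bp.
Qed.

End lsp.
End unbounded_ratio.

(** * Dimension functions and the radii of the hypothesis *)

Lemma dimension_function_small {R : realType} (h : R -> R) (e : R) :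
  dimension_function h -> 0 < e ->
  exists2 d, 0 < d & forall x, 0 <= x < d -> h x < e.
Proof.
move=> [h0 h_nd _ h_cvg] e0.
have [d /= d0 dP] : \forall x \near 0^'+, h x < e.
  by apply: (cvgr_lt 0 h_cvg).
exists d => // x /andP[x0 xd].
have d20 : 0 < d / 2 by rewrite divr_gt0.
(* The right limit says nothing at 0, so [x] is compared with a positive point by monotonicity. *)
pose y := Order.max x (d / 2).
have y0 : 0 < y by rewrite lt_max d20 orbT.
apply: (@le_lt_trans _ _ (h y)).
  by apply: h_nd => //; rewrite le_max lexx.
apply: dP => //; rewrite /= sub0r normrN gtr0_norm// gt_max xd/=; lra.
Qed.

Lemma dimension_function0 {R : realType} (h : R -> R) :
  dimension_function h -> h 0 = 0.
Proof.
move=> hd; have [h0 _ _ _] := hd; apply/eqP; rewrite eq_le h0// andbT.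
apply/ler_addgt0Pr => e e0; rewrite add0r.
by have [d d0 dP] := dimension_function_small hd e0; apply/ltW/dP; rewrite lexx.
Qed.

Section radius.
Context {R : realType}.
Variables (g f : R -> R) (lam kappa : R).
Hypothesis gG : doubling_gauge g lam.
Hypothesis g_dim : dimension_function g.
Hypothesis kappa_bd : 0 <= kappa < 1.
Hypothesis f_dim : dimension_function f.
Hypothesis fg_dim : dimension_function (fun r => f r / g r `^ kappa).

Let lam_gt0 := gauge_lam_gt0 gG.
Let g_gt0 := doubling_gt0 gG.
Let g_nd := gauge_nd gG.
Let g_ge0 := gauge_ge0 gG.

(** The bound [y < g eta] makes the set bounded. Half the supremum lies below an element of the set,
    and doubling returns to the supremum at the cost of [lam]. *)
Lemma ginv_spec (y eta : R) : 0 <= y -> 0 < eta -> y < g eta ->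
  [/\ 0 <= ginv g y <= eta, forall t, 0 <= t -> g t <= y -> t <= ginv g y &
    0 < ginv g y -> g (ginv g y) <= lam * y].
Proof.
move=> y0 eta0 yeta; rewrite /ginv; set S := [set _ | _].
have S0 : S 0 by split=> //; rewrite dimension_function0.
have Sub : ubound S eta.
  move=> t [t0 ty]; rewrite leNgt; apply/negP => /ltW et.
  by have := g_nd (ltW eta0) et; rewrite leNgt (le_lt_trans ty yeta).
have supS : has_sup S by split; [exists 0|exists eta].
have Ssup t : 0 <= t -> g t <= y -> t <= sup S.
  by move=> t0 ty; apply: (sup_upper_bound supS); split.
split=> //.
  by rewrite Ssup//= ?dimension_function0//; apply: ge_sup => //; exists 0.
move=> s0; have [|t [t0 ty] st] := @sup_adherent _ S (sup S / 2) _ supS.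
  by rewrite divr_gt0.
apply: (@le_trans _ _ (lam * g t)); last by rewrite ler_pM2l.
apply: (@le_trans _ _ (lam * g (sup S / 2))).
  by have := doubling_half gG s0; rewrite ler_pdivrMr// mulrC.
by rewrite ler_pM2l//; apply: g_nd; lra.
Qed.

(** The radius R_j is [rad (Upsilon j)], and [Y (Upsilon j)] is the value at which the inverse of
    [g] is taken. *)
Let phi u := f u / g u `^ kappa.
Let Y u := phi u `^ (1 / (1 - kappa)).
Let rad u := ginv g (Y u).

Let phi_ge0 u : 0 <= u -> 0 <= phi u.
Proof. by case: fg_dim => + _ _ _; apply. Qed.

Let k1 : 0 < 1 - kappa. Proof. by case/andP: kappa_bd; lra. Qed.

Let YK u : 0 <= u -> Y u `^ (1 - kappa) = phi u.
Proof. by move=> u0; rewrite /Y -powRrM divfK ?gt_eqF// powRr1 ?phi_ge0. Qed.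

Let powRK (x : R) : 0 <= x -> (x `^ (1 - kappa)) `^ (1 / (1 - kappa)) = x.
Proof. by move=> x0; rewrite -powRrM mulrC divfK ?gt_eqF// powRr1. Qed.

(** Small [u] make [phi u], hence [Y u] and the radius, small. A positive radius forces [Y u > 0],
    and so [f u > 0] and [u > 0]. *)
Lemma radius_spec (delta : R) : 0 < delta -> exists2 u0, 0 < u0 &
  forall u, 0 <= u < u0 -> [/\ u < delta, rad u < delta,
    0 < rad u -> 0 < f u /\ 0 < u,
    0 < rad u -> g (rad u) <= lam * Y u &
    g u <= Y u -> u <= rad u].
Proof.
move=> delta0; have d20 : 0 < delta / 2 by rewrite divr_gt0.
have e0 : 0 < g (delta / 2) `^ (1 - kappa) by apply/powR_gt0/g_gt0.
have [d d0 dP] := dimension_function_small fg_dim e0.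
exists (Order.min d delta); first by rewrite lt_min d0.
move=> u /andP[u0]; rewrite lt_min => /andP[ud udelta].
have phiu : phi u < g (delta / 2) `^ (1 - kappa) by apply: dP; rewrite u0.
have Yu : Y u < g (delta / 2).
  rewrite -(powRK (g_ge0 (ltW d20))); apply: gt0_ltr_powR => //.
  - by rewrite divr_gt0.
  - by rewrite nnegrE phi_ge0.
  - by rewrite nnegrE ltW.
have [/andP[r0 rd] rmax rle] := ginv_spec (powR_ge0 _ _) d20 Yu.
split=> //.
- by apply: le_lt_trans rd _; lra.
- move=> rpos; have := rle rpos => /(lt_le_trans (g_gt0 rpos)).
  rewrite pmulr_rgt0// => Y0.
  have fu0 : 0 < f u.
    rewrite lt_neqAle; case: f_dim => -> // _ _ _; rewrite andbT.
    apply/eqP => fu; move: Y0.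
    by rewrite /Y /phi -fu mul0r powR0 ?ltxx// gt_eqF// divr_gt0.
  split=> //; rewrite lt_neqAle u0 andbT; apply/eqP => uE.
  by move: fu0; rewrite -uE dimension_function0 ?ltxx.
- exact: rmax.
Qed.

Lemma target_le_ratio (L u : R) : 0 <= L -> 0 < u -> f u <= L * g u ->
  Y u <= L `^ (1 / (1 - kappa)) * g u.
Proof.
move=> L0 u0 fu; have gu0 := g_gt0 u0.
rewrite -[X in _ * X](powRK (ltW gu0)) -powRM ?powR_ge0//.
apply: ge0_ler_powR.
- by rewrite divr_ge0 ?ltW.
- by rewrite nnegrE phi_ge0// ltW.
- by rewrite nnegrE mulr_ge0// powR_ge0.
rewrite ler_pdivrMr ?powR_gt0// -mulrA.
by rewrite -powRD ?subrK ?powRr1 ?(ltW gu0)// (gt_eqF gu0) implybT.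
Qed.

(** With the last clause of [radius_spec], this gives [u <= rad u] for small [u] with
    [g u <= f u]. *)
Lemma target_ge (u : R) : 0 < u -> 1 <= f u / g u -> g u <= Y u.
Proof.
move=> u0 fu; have gu0 := g_gt0 u0.
rewrite -[leLHS](powRK (ltW gu0)); apply: ge0_ler_powR.
- by rewrite divr_ge0 ?ltW.
- by rewrite nnegrE powR_ge0.
- by rewrite nnegrE phi_ge0// ltW.
rewrite ler_pdivlMr ?powR_gt0//.
rewrite -powRD ?subrK ?powRr1 ?(ltW gu0)//;
  last by rewrite (gt_eqF gu0) implybT.
by move: fu; rewrite ler_pdivlMr// mul1r.
Qed.

Lemma radius_powR (u r : R) : 0 <= u -> 0 <= r -> g r <= lam * Y u ->
  g r `^ (1 - kappa) <= lam * phi u.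
Proof.
move=> u0 r0 gr; apply: (@le_trans _ _ ((lam * Y u) `^ (1 - kappa))).
  apply: ge0_ler_powR; rewrite ?nnegrE ?(ltW k1) ?g_ge0//.
  by rewrite mulr_ge0 ?powR_ge0 ?(ltW lam_gt0).
rewrite (powRM _ (ltW lam_gt0) (powR_ge0 _ _)) YK// ler_wpM2r ?phi_ge0//.
apply: powR_le_base; first exact/ltW/(gauge_lam_gt1 gG).
by case/andP: kappa_bd => *; apply/andP; split; lra.
Qed.

End radius.

Lemma limsup_nbhood_hit {R : realType} {X : metricType R} (F : nat -> set X)
    (U V : nat -> R) (x : X) (n : nat) (u0 : R) :
  (forall j, 0 <= U j) -> U @ \oo --> 0 -> limsup_nbhood F V x -> 0 < u0 ->
  exists j y, [/\ (n <= j)%N, 0 <= U j < u0, F j y & mdist x y < V j].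
Proof.
move=> U0 Ucvg; rewrite limsup_nbhoodE => xV u00.
have [N _ NP] : \forall j \near \oo, U j < u0 by apply: (cvgr_lt 0 Ucvg).
have [j /= nj /nbhoodP[y Fy xy]] := xV (maxn n N) I.
exists j, y; split=> //; first by rewrite (leq_trans _ nj)// leq_maxl.
by rewrite U0 NP//= (leq_trans _ nj)// leq_maxr.
Qed.

(** * Mass transference for neighbourhoods of sets *)

Theorem theorem1 (R : realType) (X : metricType R)
  (X_lc : locally_compact [set: X])
  (g : R -> R) (g_dim : dimension_function g) (g_dbl : doubling g)
  (g_reg : exists c1 c2 r0 : R, [/\ 0 < c1 < 1, 1 < c2, 0 < r0 &
     forall (x : X) (r : R), 0 < r < r0 ->
       ((c1 * g r)%:E <= hausdorff g (ball x r) <= (c2 * g r)%:E)%E])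
  (F : nat -> set X) (kappa : R) (kappa_bd : 0 <= kappa < 1)
  (F_lsp : local_scaling g F kappa)
  (Upsilon : nat -> R) (Upsilon_ge0 : forall j, 0 <= Upsilon j)
  (Upsilon_cvg : Upsilon @ \oo --> 0)
  (f : R -> R) (f_dim : dimension_function f)
  (fg_mono : {in `]0, +oo[ &, {homo (fun r => f r / g r) : r s / r <= s}} \/
             {in `]0, +oo[ &, {homo (fun r => f r / g r) : r s /~ r <= s}})
  (fg_dim : dimension_function (fun r => f r / g r `^ kappa))
  (g_full : forall (x : X) (r : R), 0 < r ->
     hausdorff g (ball x r `&` limsup_nbhood F
       (fun j => ginv g ((f (Upsilon j) / g (Upsilon j) `^ kappa)
                           `^ (1 / (1 - kappa)))))
     = hausdorff g (ball x r)) :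
  forall (x : X) (r : R), 0 < r ->
    hausdorff f (ball x r `&` limsup_nbhood F Upsilon)
    = hausdorff f (ball x r).
Proof.
move=> x r r_gt0.
have [lam lam1 g_lam] := g_dbl.
have [g_ge0 g_nd _ _] := g_dim.
have [f_ge0 f_nd _ _] := f_dim.
have [phi_ge0 phi_nd _ _] := fg_dim.
have gG : doubling_gauge g lam by split.
have [c1 [c2 [r0 [/andP[c10 c11] c21 r00 g_ball]]]] := g_reg.
have gA : ahlfors X g lam c1 c2 r0.
  split=> //; first exact: lt_trans c21.
    by move=> y s /(g_ball y)/andP[].
  by move=> y s /(g_ball y)/andP[].
set Lg := limsup_nbhood F _ in g_full.
have g_gt0 := doubling_gt0 gG.
have lam0 := gauge_lam_gt0 gG.
(* Common to both cases, with [T] the radius R_j. It exceeds a distance, so it is positive, and then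
   so are [Upsilon j] and its image under [f]. *)
have Lg_hit z n delta : Lg z -> 0 < delta -> exists j y T,
    [/\ (n <= j)%N, F j y, mdist z y < T < delta, 0 < Upsilon j < delta &
      [/\ 0 < f (Upsilon j),
        g T <= lam * (f (Upsilon j) / g (Upsilon j) `^ kappa) `^ (1 / (1 -
          kappa)) &
        g (Upsilon j) <= (f (Upsilon j) / g (Upsilon j) `^ kappa) `^ (1 / (1 -
          kappa)) ->
          Upsilon j <= T]].
  move=> Lz delta0.
  have [u0 u00 uP] := radius_spec gG g_dim kappa_bd f_dim fg_dim delta0.
  have [j [y [nj Uj Fy zy]]] :=
    limsup_nbhood_hit n Upsilon_ge0 Upsilon_cvg Lz u00.
  have [Ud rd rU rle rge] := uP _ Uj.
  have rpos := le_lt_trans (mdist_ge0 _ _) zy.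
  have [fU U0] := rU rpos.
  exists j, y, (ginv g ((f (Upsilon j) / g (Upsilon j) `^ kappa)
    `^ (1 / (1 - kappa)))).
  by rewrite zy rd U0 Ud; split=> //; split=> //; exact: rle.
have [[L [d [L0 d0 fL]]]|unbounded] := pselect (exists L d : R,
    [/\ 0 <= L, 0 < d & forall u, 0 < u < d -> f u <= L * g u]).
  (* The summand 1 gives [M >= 1], for the indices with [T <= Upsilon j]. *)
  pose M := lam * L `^ (1 / (1 - kappa)) + 1.
  have M1 : 1 <= M by rewrite lerDr mulr_ge0 ?powR_ge0// ltW.
  have M0 : 0 < M by exact: lt_le_trans M1.
  apply: (@hausdorff_limsup_bounded_ratio _ _ _ _ _ _ _ gA F Upsilon Lg M M0
    g_full _ f L d f_ge0 L0 d0 fL x r r_gt0).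
  move=> z n delta Lz delta0.
  have m0 : 0 < Order.min delta d by rewrite lt_min delta0.
  have [j [y [T [nj Fy /andP[zy Td] /andP[U0 Ud] [fU gT _]]]]] :=
    Lg_hit z n _ Lz m0.
  exists j, y, (Order.max T (Upsilon j)).
  move: Td Ud; rewrite !lt_min => /andP[Td _] /andP[Ud Ud'].
  split=> //.
  - by rewrite lt_max zy gt_max Td Ud.
  - by rewrite U0 le_max lexx orbT.
  have gU0 := g_gt0 _ U0.
  have [TU|UT] := leP T (Upsilon j); first by rewrite ler_peMl// ltW.
  apply: (le_trans gT).
  apply: (@le_trans _ _ (lam * (L `^ (1 / (1 - kappa)) * g (Upsilon j)))).
    rewrite ler_pM2l//; apply: (target_le_ratio gG) => //.
    by apply: fL; rewrite U0.
  by rewrite /M mulrDl (mul1r (g _)) -mulrA lerDl; exact: ltW.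
(* A nondecreasing [f / g] would be bounded on []0, 1[] by [f 1 / g 1], contrary to [unbounded]. *)
have fg_ni u v : 0 < u -> u <= v -> f v / g v <= f u / g u.
  case: fg_mono => [fg_inc|fg_dec]; last first.
    move=> u0 uv; apply: fg_dec => //; rewrite in_itv/= andbT//.
    exact: lt_le_trans uv.
  case: unbounded; exists (f 1 / g 1), 1; split=> //.
    by rewrite divr_ge0 ?f_ge0 ?g_ge0.
  move=> w /andP[w0 w1]; rewrite -ler_pdivrMr ?g_gt0//.
  by apply: fg_inc; rewrite ?in_itv/= ?andbT// ltW.
have fgoo k : exists2 d, 0 < d & forall u, 0 < u < d -> k <= f u / g u.
  apply: contrapT => nk; apply: unbounded; exists (Order.max k 0), 1;
    split=> //.
    by rewrite le_max lexx orbT.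
  move=> u /andP[u0 _]; rewrite -ler_pdivrMr ?g_gt0// leNgt; apply/negP => ku.
  apply: nk; exists u => // v /andP[v0 vu].
  apply: le_trans (fg_ni _ _ v0 (ltW vu)); apply: le_trans (ltW ku).
  by rewrite le_max lexx.
(* A point of [Lg] provides arbitrarily small positive [Upsilon j] at which [f] is positive, so [f]
   is positive on all positive reals. *)
have [x' Lx'] : Lg !=set0.
  have s0 : 0 < r0 / 2 by rewrite divr_gt0.
  apply/set0P/negP => /eqP Lg0.
  have [|lb _] := andP (g_ball x (r0 / 2) _); first by rewrite s0/=; lra.
  move: lb; rewrite -g_full// Lg0 setI0 hausdorff0// lee_fin leNgt => /negP;
    apply.
  by rewrite mulr_gt0// g_gt0.
have f_gt0 u : 0 < u -> 0 < f u.
  move=> u0; have [j [y [T [_ _ _ /andP[U0 Ud] [fU _ _]]]]] :=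
    Lg_hit _ 0%N _ Lx' u0.
  by apply: (lt_le_trans fU); apply: f_nd; exact: ltW.
have [c3 [c4 [r1 [c30 c40 r10 F_ball]]]] := F_lsp.
(* Below [d1] one has [g <= f], which makes the radius [T] at least [Upsilon j]. *)
have [d1 d10 d1P] := fgoo 1.
have Loo : hausdorff f (ball x r `&` limsup_nbhood F Upsilon) = +oo%E.
  apply: (@hausdorff_limsup_unbounded_ratio _ _ _ _ _ _ _ gA f kappa _ _ f_nd _
    _
    F Upsilon c3 c4 r1 _ _ _ F_ball Lg lam) => //.
  - by move=> u v u0; apply: phi_nd; exact: ltW.
  - move=> z n delta Lz delta0.
    have m0 : 0 < Order.min delta d1 by rewrite lt_min delta0.
    have [j [y [T [nj Fy /andP[zy Td] /andP[U0 Ud] [fU gT UT]]]]] :=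
      Lg_hit z n _ Lz m0.
    move: Td Ud; rewrite !lt_min => /andP[Td _] /andP[Ud Ud'].
    exists j, y, T; split=> //.
    + by rewrite zy.
    + rewrite U0/=; apply: UT; apply: (target_ge gG) => //.
      by apply: d1P; rewrite U0.
    apply: (radius_powR gG) => //.
    exact: le_trans (mdist_ge0 z y) (ltW zy).
  - exact/ltW/(lt_trans c11).
  - exact: f_ge0.
rewrite Loo; apply/esym/eqP; rewrite -leye_eq -Loo.
by apply: le_hausdorff => //; exact: subIsetl.
Qed.
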